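(* Let $n\ge 1$ and let $\mathcal N_1$ and $\mathcal N_2$ be two Grassmann necklaces in $\binom{[n]}{r}$. Put $\mathcal I_k=\mathcal{I}nt(\mathcal N_k)$ for $k=1,2$. Suppose that $\mathcal I_1\|\mathcal N_2$ and $\mathcal I_2\|\mathcal N_1$. Then $\mathcal I_1\cup\mathcal I_2$ is a pure system.
   Context: $[n]=\{1,\ldots,n\}$, regarded as $\mathbb Z$ modulo $n$; $\binom{[n]}{r}$ is the set of $r$-element subsets of $[n]$. For $i\in[n]$, $<_i$ is the cyclically shifted order $i<_i i+1<_i\cdots<_i n<_i 1<_i\cdots<_i i-1$. For $X,Y\in\binom{[n]}{r}$, write $X\ll_i Y$ if $x<_i y$ for all $x\in X-Y$ and $y\in Y-X$. $X$ and $Y$ are (weakly) separated, written $X\|Y$, if $X\ll_j Y$ for some $j\in[n]$. For systems $\mathcal X,\mathcal Y\subseteq\binom{[n]}{r}$, $\mathcal X\|\mathcal Y$ means that $X\|Y$ for all $X\in\mathcal X$, $Y\in\mathcal Y$; $\mathcal X$ is separated if $\mathcal X\|\mathcal X$. A system $\mathcal D\subseteq\binom{[n]}{r}$ is pure if all inclusion-wise maximal separated subsystems of $\mathcal D$ have the same size. A (Grassmann) necklace in $\binom{[n]}{r}$ is a family $\mathcal N=(N_1,\ldots,N_n)$ of sets in $\binom{[n]}{r}$ such that $N_{i+1}\supseteq N_i-\{i\}$ for each $i$ (indices modulo $n$). Standing assumption: $i\in N_i$ for every $i\in[n]$. A necklace is also regarded as the system of its members $\{N_1,\ldots,N_n\}$.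 The interior of $\mathcal N$ is $\mathcal{I}nt(\mathcal N)=\{X\in\binom{[n]}{r} : N_i\ll_i X \text{ for every } i\in[n]\}$. *)

(* Defs.v *)
From mathcomp Require Import all_boot.

Set Implicit Arguments.
Unset Strict Implicit.
Unset Printing Implicit Defensive.

(* The cyclic set [n] = Z/n is represented by 'I_n, the ordinal of value k
   standing for k + 1; the cyclic successor i + 1 is [ordS i]. *)

(* Position of x in the shifted order i, i+1, ..., i-1, counted from 0. *)
Definition shift_rank (n : nat) (i x : 'I_n) : nat := (x + (n - i)) %% n.

Definition shift_lt (n : nat) (i : 'I_n) : rel 'I_n :=
  fun x y => shift_rank i x < shift_rank i y.

Definition shift_ll (n : nat) (i : 'I_n) : rel {set 'I_n} :=
  fun X Y => [forall x in X :\: Y, forall y in Y :\: X, shift_lt i x y].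

Definition separated (n : nat) : rel {set 'I_n} :=
  fun X Y => [exists j : 'I_n, shift_ll j X Y].

Definition separated_systems (n : nat) : rel {set {set 'I_n}} :=
  fun A B => [forall X in A, forall Y in B, separated X Y].

Definition separated_system (n : nat) : pred {set {set 'I_n}} :=
  fun A => separated_systems A A.

Definition pure (n : nat) (D : {set {set 'I_n}}) : Prop :=
  let max_separated :=
    maxset (fun A : {set {set 'I_n}} => (A \subset D) && separated_system A) in
  forall A B, max_separated A -> max_separated B -> #|A| = #|B|.

Definition necklace (n r : nat) (N : 'I_n -> {set 'I_n}) : Prop :=
  (forall i, #|N i| = r) /\ (forall i, N i :\ i \subset N (ordS i)).

Definition members (n : nat) (N : 'I_n -> {set 'I_n}) : {set {set 'I_n}} :=
  [set N i | i : 'I_n].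

Definition interior (n r : nat) (N : 'I_n -> {set 'I_n}) : {set {set 'I_n}} :=
  [set X : {set 'I_n} | (#|X| == r) && [forall i, shift_ll i (N i) X]].

(* Main.v *)
(* Two sets are separated iff they do not cross, that is, iff there is no cyclic pattern p, q, r, s
   with p, r in X - Y and q, s in Y - X.

   (1) A set of size r outside Int(N) that crosses no N_i crosses no X in Int(N): the functions
   t |-> |N_i below t| - |Y below t| are unimodal on the circle and change slowly with i, while
   membership of X in the interior forces a continuous passage that unimodality forbids.

   (2) Maximal separated systems W in the level r have r(n-r)+1 members. Truncating the members of
   W at k = 0, 1, ..., n and counting pairs Z, Z + k gives the upper bound. For the lower bound,
   extend W to a maximal separated system C in all of 2^[n]; every set of at most three elements is
   the set of directions of a cube contained in C, and C has at least as many members as there are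
   sets of directions. Hence |C| >= sum_(s <= 3) binom(n, s) = sum_r (r(n-r)+1), so that the upper
   bound is attained on each level.

   (3) A maximal separated subsystem A of the union D of I_1 and I_2 contains both necklaces. Extend it to a
   maximal A' in the level; by (1) the sets in A' - D are separated from all of D, so they can be
   added to any other maximal subsystem B of D, and (2) gives |B| <= |A|. *)
Require Import Defs.
From mathcomp Require Import all_boot all_algebra zify.

Set Implicit Arguments.
Unset Strict Implicit.
Unset Printing Implicit Defensive.

(** * Positions on the circle and crossings *)

(** In (1), a failure of N_i << Y is a drop of the counting difference between two positions, and
    this drop is the same obstacle at every time [k], because N_i << N_k in the order starting at
    [i]. The minimum of the difference would have to move past it, and on the other way around the
    circle it is stopped by a valley of the difference between [Y] and [X]. In (2), the cubes in
    three directions are the hard point, since maximality only says that a set crossing no member is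
    a member. For fixed directions [a], [b] the squares in the system form a chain, which contains
    two squares made of arcs: one avoids the arc from [a] to [b] and fills the other, the second
    does the opposite. Hence every further position [c] is changed along the chain, and a cube in
    directions [a], [b], [c] appears as soon as this can be done by adding one element. That some
    element can be added concerns a single arc: among the candidates there is one that completes no
    forbidden pattern with any member. *)

Section Residues.
Variable m : nat.
Local Notation n := m.+1.
Implicit Types (X Y : {set 'I_n}) (i j x y : 'I_n) (s t u v : nat).

(** The circle is unrolled: positions are naturals read modulo [n], so a cyclic pattern becomes a
    chain of inequalities inside a window [u <= t < u + n]. *)
Definition res t : 'I_n := inZp t.

Lemma res_add t : res (t + n) = res t.
Proof. by apply: val_inj; rewrite /= modnDr. Qed.

Lemma res_val x : res x = x.
Proof. by apply: val_inj; rewrite /= modn_small. Qed.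

Lemma ordS_res t : ordS (res t) = res t.+1.
Proof. by apply: val_inj; rewrite /= -(addn1 (t %% n)) modnDml addn1. Qed.

Lemma res_inj u s t : u <= s < u + n -> u <= t < u + n -> res s = res t -> s = t.
Proof.
move=> hs ht /(congr1 val) /= e.
wlog st : s t hs ht e / s <= t.
  by move=> W; case: (leqP s t) => [|/ltnW] h; [|apply/esym]; apply: W.
have := divn_eq s n; have := divn_eq t n; rewrite {}e.
move: (s %/ n) (t %/ n) (t %% n) => a b c et es.
have [|lt_st] := leqP t s; first by lia.
have lt_ab : a < b.
  by rewrite ltnNge; apply/negP => ba; have : b * n <= a * n by [rewrite leq_mul2r ba orbT]; lia.
by have : a.+1 * n <= b * n by [rewrite leq_mul2r lt_ab orbT]; lia.
Qed.

Lemma shift_rank_res u t : u <= t < u + n -> shift_rank (res u) (res t) = t - u.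
Proof.
move=> h; rewrite /shift_rank /= modnDml.
have hu := ltn_pmod u (ltn0Sn m).
have -> : t + (n - u %% n) = (t - u) + (u %/ n).+1 * n.
  by have := divn_eq u n; nia.
by rewrite addnC modnMDl modn_small; lia.
Qed.

Lemma res_window u x : exists2 t, u <= t < u + n & res t = x.
Proof.
exists (u + shift_rank (res u) x).
  by rewrite leq_addr ltn_add2l ltn_pmod.
apply: val_inj; rewrite /= /shift_rank modnDmr /=.
have hu := ltn_pmod u (ltn0Sn m).
have -> : u + (x + (n - u %% n)) = x + (u %/ n).+1 * n.
  by have := divn_eq u n; nia.
by rewrite addnC modnMDl modn_small.
Qed.

Lemma modn_step p q : p <= q < p + n ->
  q %% n = p %% n + (q - p) \/ q %% n + n = p %% n + (q - p).
Proof.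
move=> h; have -> : q = p + (q - p) by lia.
have [d_lt r_lt] : q - p < n /\ p %% n < n by rewrite ltn_pmod //; lia.
rewrite -modnDml addKn; move: (q - p) (p %% n) d_lt r_lt => d r d_lt r_lt.
have [lt|ge] := ltnP (r + d) n; first by left; rewrite modn_small.
by right; rewrite -(subnK ge) modnDr modn_small ?subnK //; lia.
Qed.

Definition crossing X Y : Prop :=
  exists p q r s, [/\ p < q, q < r, r < s & s < p + n] /\
    [/\ res p \in X :\: Y, res q \in Y :\: X, res r \in X :\: Y & res s \in Y :\: X].

Lemma crossingC X Y : crossing X Y -> crossing Y X.
Proof.
case=> p [q [r [s [[h1 h2 h3 h4] [i1 i2 i3 i4]]]]].
by exists q, r, s, (p + n); rewrite res_add; split; split => //; lia.
Qed.

Lemma shift_llP u X Y :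
  reflect (forall s t, u <= s -> s < t -> t < u + n ->
             res s \in Y :\: X -> res t \in X :\: Y -> False)
          (shift_ll (res u) X Y).
Proof.
apply: (iffP idP) => [h s t us st tu hs ht|h].
  move/forallP: h => /(_ (res t)); rewrite ht => /forallP /(_ (res s)); rewrite hs /=.
  by rewrite /shift_lt !shift_rank_res //; lia.
apply/forallP => x; apply/implyP => hx; apply/forallP => y; apply/implyP => hy.
have [t ht et] := res_window u x; have [s hs es] := res_window u y.
rewrite /shift_lt -et -es !shift_rank_res //.
case: (ltngtP s t) => [st||st]; last 2 first.
- lia.
- by move: hy hx; rewrite -et -es st !inE => /andP[/negP ?] + /andP[].
by case: (h s t); rewrite ?et ?es //; lia.
Qed.

Lemma shift_ll_noncrossing u X Y : shift_ll (res u) X Y -> ~ crossing X Y.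
Proof.
move=> /forallP h [p [q [r [s [[h1 h2 h3 h4] [i1 i2 i3 i4]]]]]].
have lt_rank t t' : res t \in X :\: Y -> res t' \in Y :\: X ->
    shift_rank (res u) (res t) < shift_rank (res u) (res t').
  by move=> ht ht'; have := h (res t); rewrite ht => /forallP /(_ (res t')); rewrite ht'.
have := (lt_rank _ _ i1 i2, lt_rank _ _ i1 i4, lt_rank _ _ i3 i2, lt_rank _ _ i3 i4).
rewrite /shift_rank /= !modnDml; set c := n - _ => -[[[a1 a2] a3] a4].
(* Ranks wrap only once from [p] to [p + n]. As [r] ranks before [q], the wrap lies between them,
   and then [s] would rank before [p]. *)
have := @modn_step (p + c) (q + c); have := @modn_step (q + c) (r + c).
have := @modn_step (r + c) (s + c); move: a1 a2 a3 a4.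
by move: ((p + c) %% n) ((q + c) %% n) ((r + c) %% n) ((s + c) %% n); lia.
Qed.

Lemma separatedP X Y : reflect (~ crossing X Y) (separated X Y).
Proof.
apply: (iffP existsP) => [[j]|nc].
  by rewrite -(res_val j); apply: shift_ll_noncrossing.
have [/eqP XY0|[x0 x0XY]] := set_0Vmem (X :\: Y).
  by exists ord0; apply/forallP => x; rewrite (eqP XY0) inE.
pose q_ := [pred t | (x0 < t) && (res t \in Y :\: X)].
have [/existsP[y yq]|nq] := boolP [exists t : 'I_(x0 + n), q_ t]; last first.
  exists (res x0); apply/shift_llP => s t xs st tu ys xt.
  case/negP: nq; apply/existsP.
  have sl : s < x0 + n by lia.
  exists (Ordinal sl); rewrite /= ys andbT ltn_neqAle xs andbT.
  by apply: contraTneq ys => <-; move: x0XY; rewrite res_val !inE => /andP[_ ->].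
have exq : exists t, q_ t by exists y.
pose q := ex_minn exq.
have [xq yq'] : x0 < q /\ res q \in Y :\: X by rewrite /q; case: ex_minnP => ? /andP[].
have qmin t : x0 < t -> res t \in Y :\: X -> q <= t.
  by move=> a b; rewrite /q; case: ex_minnP => ? _; apply; rewrite /= a b.
have qn : q < x0 + n by apply: leq_ltn_trans (ltn_ord y); case/andP: yq => *; apply: qmin.
pose r_ := [pred t | (q < t) && (res t \in X :\: Y)].
have exr : exists t, r_ t by exists (x0 + n); rewrite /= qn res_add res_val.
pose r := ex_minn exr.
have [qr xr] : q < r /\ res r \in X :\: Y by rewrite /r; case: ex_minnP => ? /andP[].
have rmin t : q < t -> res t \in X :\: Y -> r <= t.
  by move=> a b; rewrite /r; case: ex_minnP => ? _; apply; rewrite /= a b.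
have rn : r <= x0 + n by apply: rmin; rewrite // res_add res_val.
(* In the order from [r], an element of [Y :\: X] before [q + n] either completes a crossing with
   [x0], [q], [r] or contradicts the choice of [q]; an element of [X :\: Y] after [q + n]
   contradicts the choice of [r]. *)
exists (res r); apply/shift_llP => s t rs st tr ys xt.
have qs : q + n <= s.
  rewrite leqNgt; apply/negP => sq.
  have [sx|sx] := ltnP s (x0 + n).
    apply: nc; exists x0, q, r, s; rewrite res_val; split; split => //.
    by rewrite ltn_neqAle rs andbT; apply: contraTneq ys => <-; move: xr; rewrite !inE => /andP[_ ->].
  have xs : x0 + n != s.
    by apply: contraTneq ys => <-; rewrite res_add res_val; move: x0XY; rewrite !inE => /andP[_ ->].
  have es : res s = res (s - n) by rewrite -(res_add (s - n)); congr res; lia.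
  by have := qmin (s - n); rewrite -es ys; lia.
have et : res t = res (t - n) by rewrite -(res_add (t - n)); congr res; lia.
by have := rmin (t - n); rewrite -et xt; lia.
Qed.

End Residues.

(** * Counting functions *)

Section Counting.
Variable m : nat.
Local Notation n := m.+1.
Local Notation res := (@res m).
Implicit Types (A B V X Y : {set 'I_n}) (i j x y : 'I_n) (s t u v : nat).

Definition cnt V t : nat := \sum_(0 <= u < t) (res u \in V).

Lemma cntS V t : cnt V t.+1 = cnt V t + (res t \in V).
Proof. by rewrite /cnt big_nat_recr. Qed.

Lemma cnt_add V t : cnt V (t + n) = cnt V t + #|V|.
Proof.
elim: t => [|t IH].
  rewrite add0n [cnt V 0]big_geq // add0n /cnt big_mkord -sum1_card [RHS]big_mkcond.
  by apply: eq_bigr => x _; rewrite res_val; case: (x \in V).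
by rewrite addSn !cntS IH res_add; lia.
Qed.

(** The height of the lattice path of [A] above that of [B]. For sets of equal size it is periodic,
    and they cross exactly when it has two peaks on the circle. *)
Definition diff A B t : int := ((cnt A t)%:Z - (cnt B t)%:Z)%R.

Lemma diff_add A B t : #|A| = #|B| -> diff A B (t + n) = diff A B t.
Proof. by move=> AB; rewrite /diff !cnt_add AB; lia. Qed.

Lemma diff_res A B s t : #|A| = #|B| -> res s = res t -> diff A B s = diff A B t.
Proof.
move=> AB /(congr1 val) /= st.
have red k : diff A B k = diff A B (k %% n).
  rewrite {1}(divn_eq k n); elim: (k %/ n) => [|q IH]; first by rewrite mul0n.
  by rewrite mulSn addnAC -addnA addnC diff_add // -IH addnC.
by rewrite red st -red.
Qed.

Lemma diffS A B t : diff A B t.+1 =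
  (diff A B t + (res t \in A :\: B)%:Z - (res t \in B :\: A)%:Z)%R.
Proof. by rewrite /diff !cntS !inE; case: (res t \in A); case: (res t \in B); lia. Qed.

Lemma diff_ascent A B s t : s <= t -> (diff A B s < diff A B t)%R ->
  exists2 p, s <= p < t & res p \in A :\: B.
Proof.
elim: t => [|t IH] st; first by (have -> : s = 0 by lia) => ?; lia.
have [->|ltst] := eqVneq s t.+1; first by move=> ?; lia.
rewrite diffS; have [?|nA] := boolP (res t \in A :\: B); first by exists t => //; lia.
move=> lt; have [||p hp pA] := IH; [lia | lia |].
by exists p => //; lia.
Qed.

Lemma diff_descent A B s t : s <= t -> (diff A B t < diff A B s)%R ->
  exists2 p, s <= p < t & res p \in B :\: A.
Proof. by move=> st lt; apply: diff_ascent => //; rewrite /diff in lt *; lia. Qed.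

Lemma noncrossing_unimodal A B t1 t2 t3 t4 : #|A| = #|B| -> ~ crossing A B ->
  t1 < t2 -> t2 < t3 -> t3 < t4 -> t4 < t1 + n ->
  (diff A B t1 < diff A B t2)%R -> (diff A B t1 < diff A B t4)%R ->
  (diff A B t3 < diff A B t2)%R -> (diff A B t3 < diff A B t4)%R -> False.
Proof.
move=> AB nc h1 h2 h3 h4 d12 d14 d32 d34; apply: nc.
have [p hp pA] := diff_ascent (ltnW h1) d12.
have [q hq qB] := diff_descent (ltnW h2) d32.
have [r hr rA] := diff_ascent (ltnW h3) d34.
have [|s hs sB] := @diff_descent A B t4 (t1 + n) (ltnW h4); first by rewrite diff_add.
by exists p, q, r, s; split; split => //; lia.
Qed.

(** From [u] on, all ascents come before all descents, and after [n] steps the value at [u]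
    returns. *)
Lemma shift_ll_diff_min u A B t : #|A| = #|B| -> shift_ll (res u) A B ->
  u <= t <= u + n -> (diff A B u <= diff A B t)%R.
Proof.
move=> AB /shift_llP ll ht; have [//|nle] := boolP (diff A B u <= diff A B t)%R.
have {nle} lt : (diff A B t < diff A B u)%R by lia.
have [|p hp pB] := @diff_descent A B u t _ lt; first by lia.
have [||q hq qA] := @diff_ascent A B t (u + n); [by lia | by rewrite diff_add |].
by case: (ll p q) => //; lia.
Qed.

(* For sets of equal size that do not cross, the failure of [A << B] is a failure of the Gale order. *)
Lemma not_shift_ll_diff u A B : #|A| = #|B| -> ~ crossing A B ->
  ~~ shift_ll (res u) A B -> exists2 t, u < t < u + n & (diff A B t < diff A B u)%R.
Proof.
move=> AB nc nll.
have [/existsP[[k k_lt] /= hk]|none] :=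
    boolP [exists t : 'I_(u + n), (u < t) && (diff A B t < diff A B u)%R].
  by exists k; lia.
have ge t : u < t < u + n -> (diff A B u <= diff A B t)%R.
  move=> ht; have [//|nle] := boolP (diff A B u <= diff A B t)%R.
  have {nle} lt : (diff A B t < diff A B u)%R by lia.
  have tl : t < u + n by lia.
  by case/existsP: none; exists (Ordinal tl); rewrite /= lt; lia.
case/negP: nll; apply/shift_llP => p q up pq qu pB qA.
have nqB : res q \notin B :\: A by move: qA; rewrite !inE => /andP[/negbTE -> ->].
have npA : res p \notin A :\: B by move: pB; rewrite !inE => /andP[/negbTE -> ->].
case: nc; have dp := diffS A B p; have dq := diffS A B q.
rewrite pB (negbTE npA) in dp; rewrite qA (negbTE nqB) in dq.
have gp := ge p.+1; have gq : (diff A B u <= diff A B q)%R by apply: ge; lia.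
have [||a ha aA] := @diff_ascent A B u p; [lia | lia |].
have [||b hb bB] := @diff_descent A B q.+1 (u + n); [lia | by rewrite diff_add //; lia |].
by exists a, p, q, b; split; split => //; lia.
Qed.

Lemma max_attained (f : nat -> int) s t : s <= t ->
  exists2 k, s <= k <= t & forall l, s <= l <= t -> (f l <= f k)%R.
Proof.
elim: t => [|t IH] st; first by exists 0; [lia | move=> l hl; have -> : l = 0 by lia].
have [es|lt] := eqVneq s t.+1.
  by exists t.+1; [lia | move=> l hl; have -> : l = t.+1 by lia].
have [|k hk kmax] := IH; first by lia.
have [le|gt] := boolP (f t.+1 <= f k)%R.
  exists k; first by lia.
  by move=> l hl; have [->//|ne] := eqVneq l t.+1; apply: kmax; lia.
exists t.+1; first by lia.
move=> l hl; have [->//|ne] := eqVneq l t.+1.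
by have := kmax l; lia.
Qed.

Lemma crossing_bimodal A B : #|A| = #|B| -> crossing A B ->
  exists t1 t2 t3 t4, [/\ t1 < t2, t2 < t3, t3 < t4 & t4 < t1 + n] /\
    [/\ (diff A B t1 < diff A B t2)%R, (diff A B t1 < diff A B t4)%R,
        (diff A B t3 < diff A B t2)%R & (diff A B t3 < diff A B t4)%R].
Proof.
move=> AB [p [q [r [s [[h1 h2 h3 h4] [pA qB rA sB]]]]]].
have up t : res t \in A :\: B -> diff A B t.+1 = (diff A B t + 1)%R.
  by move=> tA; rewrite diffS tA; move: tA; rewrite !inE => /andP[/negbTE -> ->] /=; lia.
have dn t : res t \in B :\: A -> (diff A B t.+1 = diff A B t - 1)%R.
  by move=> tA; rewrite diffS tA; move: tA; rewrite !inE => /andP[/negbTE -> ->] /=; lia.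
have [k2 hk2 max2] := @max_attained (diff A B) p.+1 q h1.
have [k4 hk4 max4] := @max_attained (diff A B) r.+1 s h3.
have := (up p pA, dn q qB, up r rA, dn s sB) => -[[[ep eq] er] es].
have := (max2 p.+1, max2 q, max4 r.+1, max4 s) => -[[[mp mq] mr] ms].
(* The valleys are taken on the two sides of the lower peak; they are then below both peaks. *)
have [le|gt] := boolP (diff A B k2 <= diff A B k4)%R.
  by exists p, k2, q.+1, k4; split; split; lia.
exists r, k4, s.+1, (k2 + n); rewrite diff_add //.
have e : s.+1 <= p + n by lia.
by split; split; lia.
Qed.

End Counting.

(** * Interior and exterior of a necklace *)

Section Necklace.
Variables (m r : nat) (N : 'I_m.+1 -> {set 'I_m.+1}).
Local Notation n := m.+1.
Local Notation res := (@res m).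
Hypothesis N_necklace : necklace r N.
Implicit Types (A B V X Y : {set 'I_n}) (i j x y : 'I_n) (s t u v k : nat).

Local Notation Nt k := (N (res k)).

Lemma necklace_card i : #|N i| = r.
Proof. by case: N_necklace. Qed.

Lemma necklace_persists k l e : k <= l <= e -> e < k + n ->
  res e \in Nt k -> res e \in Nt l.
Proof.
elim: l => [|l IH] hl he; first by have -> : k = 0 by lia.
have [->//|ne] := eqVneq k l.+1 => ek.
have el : res e \in Nt l by apply: IH => //; lia.
case: N_necklace => _ /(_ (res l)) /subsetP; rewrite ordS_res; apply.
rewrite !inE el andbT; apply/eqP => /(@res_inj m l) le.
by have := le; lia.
Qed.

(** An element can leave only at its own time. Hence in the window from [a] the elements lost
    between [a] and [k] lie before [k], and the gained ones do not. *)
Lemma necklace_ll a k : a <= k <= a + n -> shift_ll (res a) (Nt a) (Nt k).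
Proof.
move=> hk; apply/shift_llP => s t us st tu; rewrite !inE => /andP[sNa sNk] /andP[tNk tNa].
have tk : t < k.
  rewrite ltnNge; apply: contra tNk => kt.
  by apply: (@necklace_persists a) => //; lia.
case/negP: sNa; rewrite -res_add -[res a]res_add.
by apply: (@necklace_persists k); rewrite ?res_add //; lia.
Qed.

Lemma necklace_ll_all i j : shift_ll i (N i) (N j).
Proof.
rewrite -(res_val i); have [k hk <-] := res_window i j.
by apply: necklace_ll; lia.
Qed.

Lemma interiorP X :
  reflect (#|X| = r /\ forall i, shift_ll i (N i) X) (X \in interior r N).
Proof.
by rewrite inE; apply: (iffP andP) => [[/eqP ? /forallP ?]|[/eqP ? /forallP ?]].
Qed.

Lemma members_interior : members N \subset interior r N.
Proof.
apply/subsetP => _ /imsetP[j _ ->]; apply/interiorP.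
by split=> [|i]; [exact: necklace_card | exact: necklace_ll_all].
Qed.

Lemma interior_noncrossing X i : X \in interior r N -> ~ crossing (N i) X.
Proof. by case/interiorP => _ /(_ i); rewrite -{1}(res_val i) => /shift_ll_noncrossing. Qed.

(** Only at [x] can the count of [V] gain on that of [V'], and a window of length [n] meets [x]
    once. *)
Lemma cnt_subU1 V V' x s t : V \subset x |: V' -> s <= t <= s + n ->
  cnt V t + cnt V' s <= cnt V s + cnt V' t + 1.
Proof.
move=> /subsetP VV' hst.
have [e he ex] := res_window s x.
have aux k : s <= k <= t ->
    cnt V k + cnt V' s <= cnt V s + cnt V' k + (e < k).
  elim: k => [|k IH] hk; first by (have -> : s = 0 by lia); lia.
  have [->|ne] := eqVneq s k.+1; first by lia.
  have {}IH : cnt V k + cnt V' s <= cnt V s + cnt V' k + (e < k) by apply: IH; lia.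
  rewrite !cntS.
  have := VV' (res k); rewrite !inE -ex.
  have [/eqP|_] := boolP (res k == res e) => [|h].
    by move/(@res_inj m s) => ke; have := ke; lia.
  by move: h; case: (res k \in V) => [/(_ isT) /= -> | _]; lia.
by have := aux t; lia.
Qed.

(** Consecutive members differ by the exchange of at most one element. The bound 1 is what makes a
    discrete intermediate value argument in [k] possible. *)
Lemma necklace_step Y k s t : s <= t <= s + n ->
  let d u := (diff (Nt k.+1) Y u - diff (Nt k) Y u)%R in
  (d t - d s <= 1 /\ d s - d t <= 1)%R.
Proof.
case: N_necklace => cardN /(_ (res k)); rewrite ordS_res => sub hst /=.
have sub1 : Nt k \subset res k |: Nt k.+1.
  by apply/subsetP => x xk; rewrite !inE; case: eqP => //= /eqP nx; apply: (subsetP sub); rewrite !inE nx.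
have [j sub2] : exists j, Nt k.+1 \subset j |: Nt k.
  have : #|Nt k.+1 :\: Nt k| <= 1.
    have := cardsID (Nt k) (Nt k.+1); have := cardsID (Nt k.+1) (Nt k).
    rewrite !cardN => e1 e2.
    have : #|Nt k :\: Nt k.+1| <= 1.
      rewrite -(cards1 (res k)); apply: subset_leq_card; apply/subsetP => x.
      by rewrite !inE => /andP[xk1 xk]; move: (subsetP sub1 x xk); rewrite !inE (negbTE xk1) orbF.
    by move: e1 e2; rewrite setIC; lia.
  move/card_le1_eqP => le1.
  have [/eqP e0|[j hj]] := set_0Vmem (Nt k.+1 :\: Nt k).
    by exists ord0; rewrite setD_eq0 in e0; apply: subset_trans e0 (subsetUr _ _).
  exists j; apply/subsetP => x x1; rewrite !inE orbC.
  by case: (boolP (x \in Nt k)) => //= x0; apply/eqP/le1; rewrite // !inE x0.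
by have := cnt_subU1 sub1 hst; have := cnt_subU1 sub2 hst; rewrite /diff; lia.
Qed.

(** * Sets in the interior against sets outside it *)

Section InteriorExterior.
Variables X Y : {set 'I_n}.
Hypotheses (X_int : X \in interior r N) (Y_card : #|Y| = r).
Hypothesis (Y_sep : forall i, ~ crossing (N i) Y).

Local Notation g k := (diff (Nt k) Y).
Local Notation h := (diff Y X).

Let X_card : #|X| = r. Proof. by case/interiorP: X_int. Qed.
Let gn k t : g k (t + n) = g k t. Proof. by rewrite diff_add ?necklace_card. Qed.
Let hn t : h (t + n) = h t. Proof. by rewrite diff_add ?X_card. Qed.
Let Ntn k : Nt (k + n) = Nt k. Proof. by rewrite res_add. Qed.
Let fE k t : diff (Nt k) X t = (g k t + h t)%R. Proof. by rewrite /diff; lia. Qed.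

Let time_min k t : k <= t <= k + n -> (g k k + h k <= g k t + h t)%R.
Proof.
move=> ht; rewrite -!fE; apply: shift_ll_diff_min; rewrite ?necklace_card //.
by case/interiorP: X_int => _ /(_ (res k)).
Qed.

(** The sum [g k + h] compares [Nt k] with [X], so it has one valley, and its minimum is at [k]. If
    [g k] were not higher at [s] than at [u] or [v], then [s] would be a second valley. *)
Let barrier k u v s : u <= k <= v -> u < v -> v < s -> s < u + n ->
  (h s < h u)%R -> (h s < h v)%R -> (g k u < g k s)%R \/ (g k v < g k s)%R.
Proof.
move=> hk uv vs su hsu hsv.
have [?|ku] := boolP (g k u < g k s)%R; [by left | right].
have [//|kv] := boolP (g k v < g k s)%R.
have := @time_min k s; have := fE k k; have := fE k s; have := fE k v; have := fE k u.
have := hn u; have := gn k u; have := fE k (u + n) => un1 un2 un3 eu ev es ek mn.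
have ki : k != u by apply/eqP => e; subst k; lia.
have kj : k != v by apply/eqP => e; subst k; lia.
by case: (@noncrossing_unimodal m (Nt k) X k v s (u + n));
  rewrite ?necklace_card //; [exact: interior_noncrossing X_int | lia..].
Qed.

(** The sum [g u + h] is least at [u], while [h] is lower at [c] and [s] than at [u]; so [g u] is
    higher there. Unimodality of [g u] then excludes a second low at [v]. *)
Let start_time u c v s : u < c -> c < v -> v < s -> s < u + n ->
  (h c < h u)%R -> (h s < h u)%R ->
  [/\ (g u u < g u c)%R, (g u u < g u s)%R & (g u u < g u v)%R].
Proof.
move=> uc cv vs su hc hs; have mc := @time_min u c; have ms := @time_min u s.
have [lc ls] : (g u u < g u c)%R /\ (g u u < g u s)%R by lia.
split=> //; have [//|le] := boolP (g u u < g u v)%R.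
by case: (@noncrossing_unimodal m (Nt u) Y v s (u + n) (c + n)) => //;
  rewrite ?necklace_card ?gn //; lia.
Qed.

Let end_time u c v s : u < c -> c < v -> v < s -> s < u + n ->
  (h c < h v)%R -> (h s < h v)%R ->
  [/\ (g v v < g v s)%R, (g v v < g v c)%R & (g v v < g v u)%R].
Proof.
move=> uc cv vs su hc hs.
by have := @start_time v s (u + n) (c + n); rewrite !gn !hn; apply; lia.
Qed.

Lemma discrete_ivt (e : nat -> int) u v : u <= v -> (e u < 0)%R -> (0 < e v)%R ->
  (forall k, u <= k < v -> (e k.+1 - e k <= 1)%R) -> exists2 k, u <= k <= v & e k = 0%R.
Proof.
elim: v => [|v IH] uv eu ev st.
  by move: eu ev; (have -> : u = 0 by lia); lia.
have ne : u != v.+1 by apply/eqP => E; move: eu ev; rewrite E; lia.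
have [ev0|nev] := boolP (0 < e v)%R.
  by have [||k hk ek] := IH _ eu ev0; [lia | move=> k hk; apply: st; lia | exists k => //; lia].
by exists v; [lia | have := st v; lia].
Qed.

(* Between the times [u] and [v] the minimum of [g] would have to pass from the side of [u] to the
   side of [v], but both ways around the circle are barred, by [s] and by [a]. *)
Let minimum_cannot_pass u v c s a b1 b2 :
  u < c -> c < v -> v < s -> s < u + n ->
  (h c < h u)%R -> (h c < h v)%R -> (h s < h u)%R -> (h s < h v)%R ->
  u <= b1 -> b1 < a -> a < b2 -> b2 <= v ->
  b1 = u \/ (h b1 < h u)%R /\ (h b1 < h v)%R ->
  b2 = v \/ (h b2 < h u)%R /\ (h b2 < h v)%R ->
  (forall k, g k b1 < g k a)%R \/ (forall k, g k b2 < g k a)%R \/ (forall k, g k s < g k a)%R ->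
  False.
Proof.
move=> uc cv vs su hcu hcv hsu hsv ub1 b1a ab2 b2v low1 low2 ba.
pose mn (x y : int) := if (x <= y)%R then x else y.
(* The sign of [e] tells on which side of [a] the function [g k] is lower. At a zero of [e] both
   sides are equally low, and [a] and [s] separate them: two valleys for [Nt k] and [Y]. *)
pose e k := (mn (g k u) (g k b1) - mn (g k v) (g k b2))%R.
have [st1 st2 st3] := start_time uc cv vs su hcu hsu.
have [en1 en2 en3] := end_time uc cv vs su hcv hsv.
have eu : (e u < 0)%R.
  have : (g u u < g u b2)%R.
    by case: low2 => [->//|[? ?]]; have := @time_min u b2; lia.
  by rewrite /e /mn; do 2 case: ifP; lia.
have ev : (0 < e v)%R.
  have : (g v v < g v b1)%R.
    case: low1 => [->//|[? ?]]; have := @time_min v (b1 + n); rewrite gn hn; lia.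
  by rewrite /e /mn; do 2 case: ifP; lia.
have step k : u <= k < v -> (e k.+1 - e k <= 1)%R.
  move=> _; have hs p q : u <= p -> p <= q -> q <= v ->
      (g k.+1 p - g k p - (g k.+1 q - g k q) <= 1)%R.
    by move=> up pq qv; have [|_] := @necklace_step Y k p q; lia.
  have [s1 s2 s3 s4] : [/\ (g k.+1 u - g k u - (g k.+1 v - g k v) <= 1)%R,
      (g k.+1 u - g k u - (g k.+1 b2 - g k b2) <= 1)%R,
      (g k.+1 b1 - g k b1 - (g k.+1 v - g k v) <= 1)%R &
      (g k.+1 b1 - g k b1 - (g k.+1 b2 - g k b2) <= 1)%R] by split; apply: hs; lia.
  by rewrite /e /mn; do 4 case: ifP; lia.
have [|k hk ek0] := discrete_ivt _ eu ev step; first by lia.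
have bs := barrier hk (ltn_trans uc cv) vs su hsu hsv.
have nc := @noncrossing_unimodal m (Nt k) Y.
have Yk : #|Nt k| = #|Y| by rewrite necklace_card.
have [p hp gp] : exists2 p, u <= p < a & mn (g k u) (g k b1) = g k p.
  by rewrite /mn; case: ifP => _; [exists u => // | exists b1 => //]; lia.
have [q hq gq] : exists2 q, a < q <= v & mn (g k v) (g k b2) = g k q.
  by rewrite /mn; case: ifP => _; [exists v => // | exists b2 => //]; lia.
have epq : g k p = g k q by rewrite -gp -gq; move: ek0; rewrite /e; lia.
have [m1 m2] : (g k p <= g k b1 /\ g k q <= g k b2)%R.
  by rewrite -gp -gq /mn; do 2 case: ifP; lia.
have [m3 m4] : (g k p <= g k u /\ g k q <= g k v)%R.
  by rewrite -gp -gq /mn; do 2 case: ifP; lia.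
have qs : (g k q < g k s)%R by lia.
have pa : (g k p < g k a)%R by case: ba => [/(_ k)|[/(_ k)|/(_ k)]]; lia.
have nck : ~ crossing (Nt k) Y := @Y_sep (res k).
by have Q := nc p a q s Yk nck; apply: Q; lia.
Qed.

Let window w t : exists t', [/\ w <= t' < w + n, (forall k, g k t' = g k t) & h t' = h t].
Proof.
have [t' ht' e] := res_window w (res t); exists t'.
by split=> // [k|]; apply: diff_res; rewrite ?necklace_card ?X_card.
Qed.

(** Being below both peaks, [b] replaces the valley on its own arc: it is the [c] of
    [minimum_cannot_pass] if [a] is on the same arc between the peaks, and the [s] otherwise. *)
Let no_low_drop t1 t2 t3 t4 a b : t1 < t2 -> t2 < t3 -> t3 < t4 -> t4 < t1 + n ->
  (h t1 < h t2)%R -> (h t1 < h t4)%R -> (h t3 < h t2)%R -> (h t3 < h t4)%R ->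
  (h b < h t2)%R -> (h b < h t4)%R -> (forall k, g k b < g k a)%R -> False.
Proof.
move=> h12 h23 h34 h41 l12 l14 l32 l34.
have [b' [hb' gb' <-]] := window t2 b; have [a' [ha' ga' _]] := window t2 a.
move=> lb2 lb4 ba; have {}ba k : (g k b' < g k a')%R by rewrite ga' gb'.
clear a b ga' gb'; rename a' into a, b' into b.
have ban k : (g k (b + n) < g k a)%R by rewrite gn.
have hn1 := hn t1; have hn2 := hn t2; have hn3 := hn t3; have hnb := hn b.
have a2 : a != t2 by apply/eqP => E; have := ba t2; have := @time_min t2 b; rewrite E; lia.
have a4 : a != t4.
  apply/eqP => E; have := ba t4; have := @time_min t4 (b + n); have := @time_min t4 b.
  by rewrite gn E; lia.
have b2 : b != t2 by apply/eqP => E; move: lb2; rewrite E; lia.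
have b4 : b != t4 by apply/eqP => E; move: lb4; rewrite E; lia.
have ab : a != b by apply/eqP => E; have := ba 0; rewrite E; lia.
have [ah|al] := ltnP t4 a; have [bh|bl] := ltnP t4 b.
- have [lt|gt] := ltnP a b.
    apply: (@minimum_cannot_pass t4 (t2 + n) b (t3 + n) a t4 b); try lia.
    by right; left.
  apply: (@minimum_cannot_pass t4 (t2 + n) b (t3 + n) a b (t2 + n)); try lia.
  by left.
- apply: (@minimum_cannot_pass t4 (t2 + n) (t1 + n) (b + n) a t4 (t2 + n)); try lia.
  by right; right.
- apply: (@minimum_cannot_pass t2 t4 t3 b a t2 t4); try lia.
  by right; right.
have [lt|gt] := ltnP a b.
  apply: (@minimum_cannot_pass t2 t4 b (t1 + n) a t2 b); try lia.
  by right; left.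
apply: (@minimum_cannot_pass t2 t4 b (t1 + n) a b t4); try lia.
by left.
Qed.

Let no_high_drop t1 t2 t3 t4 a : t1 < t2 -> t2 < t3 -> t3 < t4 -> t4 < t1 + n ->
  (h t1 < h t2)%R -> (h t1 < h t4)%R -> (h t3 < h t2)%R -> (h t3 < h t4)%R ->
  (forall k, g k t2 < g k a)%R -> False.
Proof.
move=> h12 h23 h34 h41 l12 l14 l32 l34.
have [a' [ha' ga' _]] := window t2 a.
move=> ba; have {}ba k : (g k t2 < g k a')%R by rewrite ga'.
clear a ga'; rename a' into a.
have ban k : (g k (t2 + n) < g k a)%R by rewrite gn.
have hn1 := hn t1; have hn2 := hn t2; have hn3 := hn t3.
have a2 : a != t2 by apply/eqP => E; have := ba 0; rewrite E; lia.
have a4 : a != t4.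
  apply/eqP => E; have := ba t4; rewrite E.
  by have [||||||] := @end_time t2 t3 t4 (t1 + n); lia.
have [ah|al] := ltnP t4 a.
  apply: (@minimum_cannot_pass t4 (t2 + n) (t1 + n) (t3 + n) a t4 (t2 + n)); try lia.
  by right; left.
apply: (@minimum_cannot_pass t2 t4 t3 (t1 + n) a t2 t4); try lia.
by left.
Qed.

Lemma interior_exterior : Y \notin interior r N -> ~ crossing X Y.
Proof.
move=> Y_out /crossingC YX.
have [i0 nll] : exists i, ~~ shift_ll i (N i) Y.
  apply/existsP; rewrite -negb_forall; apply: contra Y_out => /forallP ll.
  exact/interiorP.
rewrite -(res_val i0) in nll; set a := nat_of_ord i0 in nll.
have [|b hab dab] := not_shift_ll_diff _ (@Y_sep (res a)) nll; first by rewrite necklace_card.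
(* The difference between [Nt a] and [Nt k] is least at [a], so passing from [Nt a] to [Nt k] keeps
   the drop from [a] to [b]. *)
have {dab} ba k : (g k b < g k a)%R.
  have := shift_ll_diff_min _ (necklace_ll_all (res a) (res k)).
  by move=> /(_ b); rewrite !necklace_card => /(_ erefl); move: dab; rewrite /diff; lia.
have [|t1 [t2 [t3 [t4 [[h12 h23 h34 h41] [l12 l14 l32 l34]]]]]] := crossing_bimodal _ YX.
  by rewrite X_card.
have [/andP[lb2 lb4]|nlow] := boolP ((h b < h t2)%R && (h b < h t4)%R).
  exact: (@no_low_drop t1 t2 t3 t4 a b).
(* Now [b] is at least as high as one peak, hence above both valleys, and it can replace the peak
   between them on its side. *)
have [b' [hb' gb' hb]] := window t1 b.
have {}ba k : (g k b' < g k a)%R by rewrite gb'.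
have b1 : b' != t1 by apply/eqP => E; move: hb; rewrite E; lia.
have b3 : b' != t3 by apply/eqP => E; move: hb; rewrite E; lia.
have [lt|gt] := ltnP b' t3.
  by apply: (@no_high_drop t1 b' t3 t4 a) => //; lia.
have hn1 := hn t1; have hn2 := hn t2.
by apply: (@no_high_drop t3 b' (t1 + n) (t2 + n) a) => //; lia.
Qed.

End InteriorExterior.

End Necklace.

(** * Inserting one element on an arc *)

Ltac is_nat x := lazymatch type of x with nat => idtac end.

(* [lia] alone is slow when the context holds many membership hypotheses. *)
Ltac poslia :=
  repeat match goal with
  | H : ?T |- _ =>
      lazymatch T with
      | is_true (leq _ _) => fail
      | is_true (leq _ _ && leq _ _) => fail
      | @eq nat _ _ => fail
      | is_true (negb (eq_op ?x _)) => tryif is_nat x then fail else clear H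
      | nat => fail
      | _ => clear H
      end
  end; lia.

Section Insertion.
Variable K : nat.
Implicit Types (P Q Z A B D F G : {set 'I_K}) (b d e f g p q t x y z : 'I_K).

Lemma last_sat (S : pred 'I_K) x : S x -> exists2 y, S y & forall z, S z -> z <= y.
Proof. by move=> Sx; case: (@arg_maxnP _ x S val Sx) => y Sy ymax; exists y. Qed.

Lemma first_sat (S : pred 'I_K) x : S x -> exists2 y, S y & forall z, S z -> y <= z.
Proof. by move=> Sx; case: (@arg_minnP _ x S val Sx) => y Sy ymin; exists y. Qed.

Definition inversion P Q : Prop :=
  exists x y, [/\ x < y, x \in P :\: Q & y \in Q :\: P].

Definition surrounds P Q : Prop :=
  exists x y z, [/\ x < y, y < z, x \in P :\: Q, y \in Q :\: P & z \in P :\: Q].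

Definition alternates P Q : Prop :=
  exists x y z t, [/\ x < y, y < z & z < t] /\
    [/\ x \in P :\: Q, y \in Q :\: P, z \in P :\: Q & t \in Q :\: P].

(* The positions are those of the arc from [a] to [b]. The families are the traces of the members
   that avoid [a] and [b] ([FA]), contain both ([FF]), only [b] ([FB]) or only [a] ([FD]). The
   hypotheses are the patterns that [a] and [b] would complete to a crossing. *)
Variables (FA FB FD FF : {set {set 'I_K}}) (Z Z' : {set 'I_K}).
Hypotheses
  (AZ : forall A, A \in FA -> ~ surrounds A Z /\ ~ surrounds A Z')
  (FZ : forall F, F \in FF -> ~ surrounds Z F /\ ~ surrounds Z' F)
  (DZ : forall D, D \in FD -> ~ inversion Z D /\ ~ inversion Z' D)
  (BZ : forall B, B \in FB -> ~ inversion B Z /\ ~ inversion B Z')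
  (AA : forall A A', A \in FA -> A' \in FA -> ~ alternates A A')
  (FF' : forall F F', F \in FF -> F' \in FF -> ~ alternates F F')
  (AB : forall A B, A \in FA -> B \in FB -> ~ surrounds A B)
  (AD : forall A D, A \in FA -> D \in FD -> ~ surrounds A D)
  (AF : forall A F, A \in FA -> F \in FF -> ~ surrounds A F)
  (BF : forall B F, B \in FB -> F \in FF -> ~ surrounds B F)
  (DF : forall D F, D \in FD -> F \in FF -> ~ surrounds D F)
  (BD : forall B D, B \in FB -> D \in FD -> ~ inversion B D)
  (ZZ' : Z \subset Z').

(* Positions that are visible when only the part [G] of [Z' :\: Z] is kept. *)
Definition visible G A : {set 'I_K} := A :\: Z :\: ((Z' :\: Z) :\: G).

(** The cases follow the role of [p] in a new pattern: the middle of a surrounding by [A], the left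
    end of an inversion against [D], the right end of one of [B], the left or right end of a
    surrounding of [F]. *)
Definition blockedA G p A :=
  (p \notin A) && [exists x : 'I_K, exists z : 'I_K, [&& x < p, p < z, x \in visible G A & z \in visible G A]].
Definition blockedD G p D := (p \notin D) && [exists d : 'I_K, [&& p < d, d \in D & d \in G]].
Definition blockedB G p B := (p \notin B) && [exists b : 'I_K, [&& b < p, b \in B & b \in G]].
Definition blockedFr G p F :=
  (p \notin F) && [exists f : 'I_K, exists z : 'I_K, [&& p < f, f < z, f \in F, f \in G & z \in Z :\: F]].
Definition blockedFl G p F :=
  (p \notin F) && [exists f : 'I_K, exists z : 'I_K, [&& z < f, f < p, f \in F, f \in G & z \in Z :\: F]].

(* For [G = Z' :\: Z], adding a free [p] to [Z] creates no forbidden pattern; smaller [G] serve the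
   induction. *)
Definition free G p :=
  [/\ forall A, A \in FA -> ~~ blockedA G p A,
      forall D, D \in FD -> ~~ blockedD G p D,
      forall B, B \in FB -> ~~ blockedB G p B &
      forall F, F \in FF -> ~~ blockedFr G p F /\ ~~ blockedFl G p F].

Lemma blockedDP G p D d : ~~ blockedD G p D -> d \in D -> d \in G -> p < d -> p \in D.
Proof.
move=> nb dD dG pd; apply: contraNT nb => pD; rewrite /blockedD pD.
by apply/existsP; exists d; rewrite pd dD dG.
Qed.

Lemma blockedFrP G p F f z : ~~ blockedFr G p F -> f \in F -> f \in G -> z \in Z :\: F ->
  p < f -> f < z -> p \in F.
Proof.
move=> nb fF fG zF pf fz; apply: contraNT nb => pF; rewrite /blockedFr pF.
by apply/existsP; exists f; apply/existsP; exists z; rewrite pf fz fF fG zF.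
Qed.

(* The maximal element of [G] is not blocked to the right; the least such element is free. *)
Lemma free_without_gaps G : G \subset Z' :\: Z -> G != set0 ->
  (forall A p, A \in FA -> p \in G -> ~~ blockedA G p A) ->
  exists2 p, p \in G & free G p.
Proof.
move=> subG /set0Pn[g0 g0G] noA.
have GZ x : x \in G -> x \notin Z by move/(subsetP subG); rewrite inE => /andP[].
pose good p := (p \in G) && [forall D in FD, ~~ blockedD G p D] && [forall F in FF, ~~ blockedFr G p F].
have [g gG gmax] := @last_sat [in G] g0 g0G.
have gg : good g.
  rewrite /good gG /=; apply/andP; split; apply/forall_inP => U _; apply/nandP; right.
    by rewrite negb_exists; apply/forallP => d; apply/negP => /and3P[gd _ /gmax]; poslia.
  rewrite negb_exists; apply/forallP => f; rewrite negb_exists; apply/forallP => z.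
  by apply/negP => /and5P[gf _ _ /gmax]; poslia.
have [p /andP[/andP[pG /forall_inP pD] /forall_inP pF] pmin] := @first_sat good g gg.
have blocked x : x \in G -> x < p ->
    (exists2 D, D \in FD & blockedD G x D) \/ (exists2 F, F \in FF & blockedFr G x F).
  move=> xG xp; have : ~~ good x by apply/negP => /pmin; rewrite leqNgt xp.
  rewrite /good xG /= negb_and => /orP[]; rewrite negb_forall => /existsP[U];
    rewrite negb_imply negbK => /andP[U1 U2]; [left | right]; by exists U.
exists p => //; split=> [A /noA|||F FFF]; [exact | exact: pD | |].
  (* The last [b] through which [B] blocks [p] is not good, so some [D] or [F] blocks it by an
     element [d] or [f]. That element must lie in [B], hence beyond [p]; as [p] is good, the
     blocking set contains [p], and then so does [B]. *)
  move=> B BFB; apply/negP => /andP[pB /existsP[b0 hb0]].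
  have [b /and3P[bp bB bG] bmax] := @last_sat (fun b => [&& b < p, b \in B & b \in G]) b0 hb0.
  have above x : x \in B -> x \in G -> b < x -> p < x.
    move=> xB xG bx; rewrite ltn_neqAle; apply/andP; split.
      by apply: contra pB => /eqP/val_inj ->.
    by rewrite leqNgt; apply/negP => xp; have := bmax x; rewrite xp xB xG => /(_ isT); poslia.
  have [[D DFD /andP[bD /existsP[d /and3P[bd dD dG]]]]|] := blocked b bG bp.
    have inB x : x \in D -> b < x -> x \in B.
      move=> xD bx; apply/negPn/negP => xB; case: (BD BFB DFD).
      by exists b, x; rewrite !inE bB bD xB xD.
    have pd := above d (inB d dD bd) dG bd.
    by move/negP: pB; apply; apply: (inB p _ bp); apply: (blockedDP (pD D DFD) dD dG pd).
  case=> F FFF /andP[bF /existsP[f /existsP[z /and5P[bf fz fF fG zF]]]].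
  have inB x : x \in F -> b < x -> x < z -> x \in B.
    move=> xF bx xz; apply/negPn/negP => xB; move: (zF); rewrite inE => /andP[zF' zZ].
    have [zB|zB] := boolP (z \in B).
      by case: (BF BFB FFF); exists b, x, z; rewrite !inE bB bF xB xF zF' zB.
    case: (BZ BFB) => + _; apply.
    by exists b, z; rewrite !inE bB zB zZ (GZ b bG); split=> //; poslia.
  have pf := above f (inB f fF bf fz) fG bf.
  move/negP: pB; apply; apply: (inB p _ bp); last by poslia.
  exact: (blockedFrP (pF F FFF) fF fG zF pf fz).
split; first exact: pF.
apply/negP => /andP[pF' /existsP[f0 /existsP[z0 hz0]]].
move: FFF pF' hz0; rename F into E => EFF pE /and5P[zf0 fp0 fE0 fG0 zE].
have hf0 : [&& z0 < f0, f0 < p, f0 \in E & f0 \in G] by rewrite zf0 fp0 fE0.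
(* The argument for [B] again, with [e] for [b]; keeping [e] beyond [z0] lets [z0] open the excluded
   patterns. *)
have [e /and4P[ze ep eE eG] emax] := @last_sat (fun e => [&& z0 < e, e < p, e \in E & e \in G]) f0 hf0.
have above x : x \in E -> x \in G -> e < x -> p < x.
  move=> xE xG ex; rewrite ltn_neqAle; apply/andP; split.
    by apply: contra pE => /eqP/val_inj ->.
  rewrite leqNgt; apply/negP => xp; have := emax x; rewrite xp xE xG (ltn_trans ze ex) => /(_ isT); poslia.
move: (zE); rewrite inE => /andP[zE' zZ].
have [[D DFD /andP[eD /existsP[d /and3P[ed dD dG]]]]|] := blocked e eG ep.
  have inE' x : x \in D -> e < x -> x \in G -> x \in E.
    move=> xD ex xG; apply/negPn/negP => xE.
    have [zD|zD] := boolP (z0 \in D).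
      by case: (DF DFD EFF); exists z0, e, x; rewrite !inE zE' zD eE eD xE xD.
    case: (DZ DFD) => + _; apply.
    by exists z0, x; rewrite !inE zD zZ xD (GZ x xG); split=> //; poslia.
  have pd := above d (inE' d dD ed dG) dG ed.
  by move/negP: pE; apply; apply: (inE' p _ ep pG); apply: (blockedDP (pD D DFD) dD dG pd).
case=> F FFF /andP[eF /existsP[f /existsP[z /and5P[ef fz fF fG zF]]]].
move: (zF); rewrite inE => /andP[zF' zZ'].
have inE' x : x \in F -> e < x -> x < z -> x \in G -> x \in E.
  move=> xF ex xz xG; apply/negPn/negP => xE.
  have [z0F|z0F] := boolP (z0 \in F); last first.
    case: (FZ FFF) => + _; apply; exists z0, x, z.
    by rewrite !inE z0F zZ xF (GZ x xG) zF' zZ'; split=> //; poslia.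
  have [zE2|zE2] := boolP (z \in E).
    by case: (FF' FFF EFF); exists z0, e, x, z; rewrite !inE zE' z0F eE eF xE xF zE2 zF'.
  case: (FZ EFF) => + _; apply; exists z0, e, z.
  by rewrite !inE zE' zZ eE (GZ e eG) zE2 zZ'; split=> //; poslia.
have pf := above f (inE' f fF ef fz fG) fG ef.
move/negP: pE; apply; apply: (inE' p _ ep _ pG); last by poslia.
exact: (blockedFrP (pF F FFF) fF fG zF pf fz).
Qed.

Lemma visible_kept G A x : x \in visible G A -> x \in Z' -> x \in G.
Proof. by rewrite !inE => /and3P[+ xZ xA] xZ'; rewrite xZ xZ' !andbT negbK. Qed.

(* The gaps of a blocking member of [FA] with the shortest hull are deleted from [G]; an element that
   is free for the rest stays free for [G]. *)
Lemma free_exists G : G \subset Z' :\: Z -> G != set0 -> exists2 p, p \in G & free G p.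
Proof.
have [k] := ubnP #|G|; elim: k G => // k IH G Gk subG G0.
have GZ x : x \in G -> (x \notin Z) && (x \in Z') by move/(subsetP subG); rewrite inE.
pose blocks A := (A \in FA) && [exists p in G, blockedA G p A].
have [/existsP[A0 hA0]|none] := boolP [exists A, blocks A]; last first.
  apply: free_without_gaps => // A p AFA pG; apply: contra none => b.
  by apply/existsP; exists A; rewrite /blocks AFA; apply/exists_inP; exists p.
pose hull A := [set x : 'I_K | [exists l in visible G A, exists h in visible G A, (l <= x) && (x <= h)]].
have hullP A l x h : l \in visible G A -> h \in visible G A -> l <= x -> x <= h -> x \in hull A.
  move=> lA hA lx xh; rewrite inE; apply/exists_inP; exists l => //; apply/exists_inP; exists h => //.
  by rewrite lx.
case: (@arg_minnP _ A0 blocks (fun A => #|hull A|) hA0) => A /andP[AFA /exists_inP[p0 p0G p0A]] Amin.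
pose G1 := [set g in G | ~~ blockedA G g A].
have inG1 x : x \in G -> x \in A -> x \in G1 by move=> xG xA; rewrite inE xG /blockedA xA.
have visZ x : x \in visible G A -> (x \notin Z) && (x \in A) by rewrite !inE => /and3P[_ -> ->].
have visG1 x : x \in visible G A -> x \in Z' -> x \in G1.
  by move=> xv xZ'; apply: inG1; [exact: (visible_kept xv) | case/andP: (visZ x xv)].
have subG1 : G1 \subset G by apply/subsetP => x; rewrite inE => /andP[].
have G1lt : #|G1| < k.
  rewrite -ltnS (leq_trans _ Gk) // ltnS; apply: proper_card; rewrite properE subG1.
  by apply/subsetPn; exists p0 => //; rewrite inE p0G p0A.
(* As [A] does not surround [Z'], one end of a blocking pair lies in [Z']. Being visible it belongs
   to [G], and being in [A] it is kept. *)
have G10 : G1 != set0.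
  case/andP: (p0A) => pA /existsP[l /existsP[h /and4P[lp ph lv hv]]].
  have [lZ'|lZ'] := boolP (l \in Z'); first by apply/set0Pn; exists l; apply: visG1.
  have [hZ'|hZ'] := boolP (h \in Z'); first by apply/set0Pn; exists h; apply: visG1.
  case: (AZ AFA) => _; case; exists l, p0, h.
  case/andP: (visZ l lv) => _ lA; case/andP: (visZ h hv) => _ hA; case/andP: (GZ p0 p0G) => _ pZ'.
  by rewrite !inE lZ' lA hZ' hA pA pZ'; split.
have [p pG1 [freeA freeD freeB freeF]] := IH G1 G1lt (subset_trans subG1 subG) G10.
have pG : p \in G := subsetP subG1 p pG1.
have [pZ pZ'] := andP (GZ p pG).
(* The gap of [A] around [g] can be bounded on the side of [p] where [g] lies: [p] is not blocked by
   [A], so between two visible positions it is itself visible in [A] and can serve as an end. *)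
have deleted g : g \in G -> g \notin G1 -> [/\ g \notin A,
    p < g -> exists a a' : 'I_K, [/\ p <= a, a < g, g < a', a \in visible G A & a' \in visible G A] &
    g < p -> exists a a' : 'I_K, [/\ a' <= p, a < g, g < a', a \in visible G A & a' \in visible G A]].
  move=> gG; rewrite inE gG /= negbK => /andP[gA /existsP[l /existsP[h /and4P[lg gh lv hv]]]].
  have pv : l < p -> p < h -> p \in visible G A.
    move=> lp ph; have : ~~ blockedA G p A by move: pG1; rewrite inE => /andP[].
    rewrite /blockedA negb_and negbK => /orP[pA|].
      by rewrite !inE pG pZ pA.
    by move/existsPn => /(_ l) /existsPn /(_ h); rewrite lp ph lv hv.
  split=> // [pg|gp].
    have [pl|lp] := leqP p l; first by exists l, h.
    by exists p, h; split=> //; apply: pv => //; poslia.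
  have [hp|ph] := leqP h p; first by exists l, h.
  by exists l, p; split=> //; apply: pv => //; poslia.
exists p => //; split.
- move=> E EFA; apply/negP => bE; case/andP: (bE) => pE /existsP[l1 /existsP[h1 /and4P[l1p ph1 l1v h1v]]].
  have visE x : x \in visible G A -> x \in E -> (x \in visible G E) && (x \in visible G1 E).
    move=> xv xE; have := visG1 x xv; move: (xv).
    rewrite /visible !in_setD xE => /and3P[-> -> _] /=.
    by case: (x \in Z') => [/(_ isT) ->|]; rewrite ?andbF.
  have visA x : x \in visible G E -> x \in A -> x \in visible G A.
    by rewrite !inE => /and3P[-> -> _] ->.
  have visEE x : x \in visible G E -> x \in E by rewrite !inE => /and3P[].
  have delE x : x \in visible G E -> x \notin visible G1 E -> x \in G /\ x \notin G1.
    rewrite /visible !in_setD => /and3P[+ xZ ->]; rewrite xZ.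
    by case: (x \in Z'); rewrite /= ?andbT ?andbF /= ?andbF ?negbK //=.
  have smaller w : w \in hull A -> w \notin hull E ->
      (forall x, x \in visible G E -> x \in hull A) -> False.
    move=> wA wE inA; have blE : blocks E by rewrite /blocks EFA; apply/exists_inP; exists p.
    have := Amin E blE; rewrite leqNgt => /negP; apply; apply: proper_card.
    rewrite properE; apply/andP; split; last by apply/subsetPn; exists w.
    apply/subsetP => x; rewrite inE => /exists_inP[l lE /exists_inP[h hE /andP[lx xh]]].
    move: (inA l lE) (inA h hE); rewrite !inE => /exists_inP[l2 l2A /exists_inP[_ _ /andP[l2l _]]].
    move=> /exists_inP[_ _ /exists_inP[h2 h2A /andP[_ hh2]]].
    apply/exists_inP; exists l2 => //; apply/exists_inP; exists h2 => //.
    by rewrite (leq_trans l2l lx) (leq_trans xh hh2).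
  (* Since [p] is free for [G1], on one side of [p] all positions of [E] visible for [G] were
     deleted and lie in gaps of [A]. As [A] and [E] do not alternate, the hull of [E] is then
     strictly inside that of [A]. *)
  have [/existsP[h2 /andP[ph2 h2v]]|right] := boolP [exists h : 'I_K, (p < h) && (h \in visible G1 E)].
    have left x : x \in visible G E -> x < p -> x \in G /\ x \notin G1.
      move=> xv xp; apply: delE => //; apply/negP => xv1; have := freeA E EFA.
      by rewrite /blockedA pE => /existsPn /(_ x) /existsPn /(_ h2); rewrite xp ph2 xv1 h2v.
    have [l1G l1G1] := left l1 l1v l1p.
    have [l1A _ /(_ l1p)[a [a' [a'p al1 l1a' av a'v]]]] := deleted l1 l1G l1G1.
    have [[aZ aA] [a'Z a'A]] := (andP (visZ a av), andP (visZ a' a'v)).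
    have notE x : x \in visible G A -> x < p -> x \notin E.
      move=> xv xp; apply/negP => /(visE x xv)/andP[xE _]; have [xG] := left x xE xp.
      by rewrite inG1 //; case/andP: (visZ x xv).
    have aE : a \notin E by apply: notE => //; poslia.
    have a'E : a' \notin E.
      have [a'p'|a'p'] := ltnP a' p; first exact: notE.
      by have -> : a' = p by apply: val_inj => /=; poslia.
    have l1E := visEE l1 l1v.
    apply: (smaller a); first exact: (hullP A a a a).
      apply/negP; rewrite inE => /exists_inP[l lv /exists_inP[_ _ /andP[la _]]].
      have lE := visEE l lv; have lp : l < p by poslia.
      have [lG lG1] := left l lv lp; have [lA _ _] := deleted l lG lG1.
      have la' : l != a by apply: contraNneq lA => ->.
      case: (AA EFA AFA); exists l, a, l1, a'; rewrite !inE lE lA aA aE l1E l1A a'A a'E.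
      by split; split=> //; move: la'; rewrite -val_eqE /=; poslia.
    move=> x xv; have xE := visEE x xv.
    have [xp|px|xp] := ltngtP x p; last by move: xE; rewrite (val_inj xp) (negbTE pE).
      have [xG xG1] := left x xv xp.
      by have [_ _ /(_ xp)[b [b' [_ bx xb' bv b'v]]]] := deleted x xG xG1; apply: (hullP A b x b') => //; poslia.
    have xA : x \in A.
      apply/negPn/negP => xA; case: (AA AFA EFA); exists a, l1, a', x.
      by rewrite !inE xE xA aA aE l1E l1A a'A a'E; split; split=> //; poslia.
    by apply: (hullP A x x x); rewrite ?visA.
  have {}right x : x \in visible G E -> p < x -> x \in G /\ x \notin G1.
    move=> xv px; apply: delE => //; apply/negP => xv1; case/negP: right.
    by apply/existsP; exists x; rewrite px.
  have [h1G h1G1] := right h1 h1v ph1.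
  have [h1A /(_ ph1)[a [a' [pa ah1 h1a' av a'v]]] _] := deleted h1 h1G h1G1.
  have [[aZ aA] [a'Z a'A]] := (andP (visZ a av), andP (visZ a' a'v)).
  have notE x : x \in visible G A -> p < x -> x \notin E.
    move=> xv px; apply/negP => /(visE x xv)/andP[xE _]; have [xG] := right x xE px.
    by rewrite inG1 //; case/andP: (visZ x xv).
  have a'E : a' \notin E by apply: notE => //; poslia.
  have aE : a \notin E.
    have [pa'|pa'] := ltnP p a; first exact: notE.
    by have -> : a = p by apply: val_inj => /=; poslia.
  have h1E := visEE h1 h1v.
  apply: (smaller a'); first exact: (hullP A a' a' a').
    apply/negP; rewrite inE => /exists_inP[_ _ /exists_inP[h hv /andP[_ ah]]].
    have hE := visEE h hv; have ph : p < h by poslia.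
    have [hG hG1] := right h hv ph; have [hA _ _] := deleted h hG hG1.
    have ha' : h != a' by apply: contraNneq hA => ->.
    case: (AA AFA EFA); exists a, h1, a', h; rewrite !inE hE hA aA aE h1E h1A a'A a'E.
    by split; split=> //; move: ha'; rewrite -val_eqE /=; poslia.
  move=> x xv; have xE := visEE x xv.
  have [xp|px|xp] := ltngtP x p; last by move: xE; rewrite (val_inj xp) (negbTE pE).
    have xA : x \in A.
      apply/negPn/negP => xA; case: (AA EFA AFA); exists x, a, h1, a'.
      by rewrite !inE xE xA aA aE h1E h1A a'A a'E; split; split=> //; poslia.
    by apply: (hullP A x x x); rewrite ?visA.
  have [xG xG1] := right x xv px.
  by have [_ /(_ px)[b [b' [_ bx xb' bv b'v]]] _] := deleted x xG xG1; apply: (hullP A b x b') => //; poslia.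
- move=> D DFD; apply/negP => /andP[pD /existsP[d /and3P[pd dD dG]]].
  have dG1 : d \notin G1 by apply: contra pD => dG1; apply: (blockedDP (freeD D DFD) dD dG1 pd).
  (* Both ends of the gap around [d] turn out to be outside [D], so [A] surrounds [D]. *)
  have [dA /(_ pd)[a [a' [pa ad da' av a'v]]] _] := deleted d dG dG1.
  have [[aZ aA] [a'Z a'A]] := (andP (visZ a av), andP (visZ a' a'v)).
  have notD x : x \in visible G A -> p < x -> x \notin D.
    move=> xv px; apply: contra (pD) => xD; apply: (blockedDP (freeD D DFD) xD _ px).
    apply: visG1 => //; apply/negPn/negP => xZ'; case: (DZ DFD) => _; apply.
    by exists p, x; rewrite !inE xZ' xD pZ' pD.
  have a'D : a' \notin D by apply: notD => //; poslia.
  have aD : a \notin D.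
    have [pa'|pa'] := ltnP p a; first exact: notD.
    by have -> : a = p by apply: val_inj => /=; poslia.
  by case: (AD AFA DFD); exists a, d, a'; rewrite !inE aA aD dD dA a'A a'D.
- move=> B BFB; apply/negP => /andP[pB /existsP[b /and3P[bp bB bG]]].
  have freeBP x : x \in B -> x \in G1 -> x < p -> p \in B.
    move=> xB xG1 xp; apply/negPn/negP => pB'; have := freeB B BFB; rewrite /blockedB pB'.
    by move/existsPn => /(_ x); rewrite xp xB xG1.
  have bG1 : b \notin G1 by apply: contra pB => bG1; apply: (freeBP b).
  have [bA _ /(_ bp)[a [a' [a'p ab ba' av a'v]]]] := deleted b bG bG1.
  have [[aZ aA] [a'Z a'A]] := (andP (visZ a av), andP (visZ a' a'v)).
  have notB x : x \in visible G A -> x < p -> x \notin B.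
    move=> xv xp; apply: contra (pB) => xB; apply: (freeBP x) => //.
    apply: visG1 => //; apply/negPn/negP => xZ'; case: (BZ BFB) => _; apply.
    by exists x, p; rewrite !inE xZ' xB pZ' pB.
  have aB : a \notin B by apply: notB => //; poslia.
  have a'B : a' \notin B.
    have [pa'|pa'] := ltnP a' p; first exact: notB.
    by have -> : a' = p by apply: val_inj => /=; poslia.
  by case: (AB AFA BFB); exists a, b, a'; rewrite !inE aA aB bB bA a'A a'B.
move=> F FFF; have [freeFr freeFl] := freeF F FFF.
have freeFlP f z : f \in F -> f \in G1 -> z \in Z :\: F -> f < p -> z < f -> p \in F.
  move=> fF fG1 zF fp zf; apply/negPn/negP => pF; move: freeFl; rewrite /blockedFl pF.
  by move/existsPn => /(_ f) /existsPn /(_ z); rewrite fp zf fF fG1 zF.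
have ZZ'x z : z \in Z -> z \in Z' by move/(subsetP ZZ').
split; apply/negP => /andP[pF /existsP[f /existsP[z /and5P[]]]].
  move=> pf fz fF fG zF.
  have fG1 : f \notin G1 by apply: contra pF => fG1; apply: (blockedFrP freeFr fF fG1 zF pf fz).
  have [fA /(_ pf)[a [a' [pa af fa' av a'v]]] _] := deleted f fG fG1.
  have [[aZ aA] [a'Z a'A]] := (andP (visZ a av), andP (visZ a' a'v)).
  move: (zF); rewrite inE => /andP[zF' zZ].
  have notF x : x \in visible G A -> p < x -> x < z -> x \notin F.
    move=> xv px xz; apply: contra (pF) => xF; apply: (blockedFrP freeFr xF _ zF px xz).
    apply: visG1 => //; apply/negPn/negP => xZ'; case: (FZ FFF) => _; apply.
    by exists p, x, z; rewrite !inE xZ' xF pZ' pF zF' ZZ'x.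
  have aF : a \notin F.
    have [pa'|pa'] := ltnP p a; first by apply: notF => //; poslia.
    by have -> : a = p by apply: val_inj => /=; poslia.
  (* Otherwise [A] surrounds [F] at the gap. This forces [a'] beyond [z]; then [z] is in [A], which
     does not surround [Z], and [A] surrounds [F] at [a], [f], [z]. *)
  have a'F : a' \in F.
    apply/negPn/negP => a'F; case: (AF AFA FFF); exists a, f, a'.
    by rewrite !inE aA aF fF fA a'A a'F.
  have za' : z < a'.
    rewrite ltnNge; apply/negP => a'z; suff: a' \notin F by rewrite a'F.
    apply: notF => //; first by poslia.
    by rewrite ltn_neqAle a'z andbT; apply: contraTneq a'F => /val_inj ->.
  have zA : z \in A.
    apply/negPn/negP => zA; case: (AZ AFA) => + _; apply; exists a, z, a'.
    by rewrite !inE aA aZ zZ zA a'A a'Z; split=> //; poslia.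
  by case: (AF AFA FFF); exists a, f, z; rewrite !inE aA aF fF fA zA zF'.
move=> zf fp fF fG zF.
have fG1 : f \notin G1 by apply: contra pF => fG1; apply: (freeFlP f z).
have [fA _ /(_ fp)[a [a' [a'p af fa' av a'v]]]] := deleted f fG fG1.
have [[aZ aA] [a'Z a'A]] := (andP (visZ a av), andP (visZ a' a'v)).
move: (zF); rewrite inE => /andP[zF' zZ].
have notF x : x \in visible G A -> x < p -> z < x -> x \notin F.
  move=> xv xp zx; apply: contra (pF) => xF; apply: (freeFlP x z) => //.
  apply: visG1 => //; apply/negPn/negP => xZ'; case: (FZ FFF) => _; apply.
  by exists z, x, p; rewrite !inE xZ' xF pZ' pF zF' ZZ'x.
have a'F : a' \notin F.
  have [pa'|pa'] := ltnP a' p; first by apply: notF => //; poslia.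
  by have -> : a' = p by apply: val_inj => /=; poslia.
have aF : a \in F.
  apply/negPn/negP => aF; case: (AF AFA FFF); exists a, f, a'.
  by rewrite !inE aA aF fF fA a'A a'F.
have az : a < z.
  rewrite ltnNge; apply/negP => za; suff: a \notin F by rewrite aF.
  apply: notF => //; first by poslia.
  by rewrite ltn_neqAle za andbT; apply: contraTneq aF => /val_inj <-.
have zA : z \in A.
  apply/negPn/negP => zA; case: (AZ AFA) => + _; apply; exists a, z, a'.
  by rewrite !inE aA aZ zZ zA a'A a'Z; split=> //; poslia.
by case: (AF AFA FFF); exists z, f, a'; rewrite !inE a'A a'F fF fA zA zF'.
Qed.

(** A forbidden pattern of [p |: Z] uses [p], since [Z] has none, and its elements from [D], [B] or
    [F] lie in [Z'], since [Z'] has none. What is left is a blocking of [p]. *)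
Lemma insertion : Z != Z' -> exists2 p, p \in Z' :\: Z &
  [/\ forall A, A \in FA -> ~ surrounds A (p |: Z),
      forall D, D \in FD -> ~ inversion (p |: Z) D,
      forall B, B \in FB -> ~ inversion B (p |: Z) &
      forall F, F \in FF -> ~ surrounds (p |: Z) F].
Proof.
move=> neq; have G0 : Z' :\: Z != set0.
  by rewrite setD_eq0; apply: contra neq => sub; rewrite eqEsubset ZZ'.
have [p pG [freeA freeD freeB freeF]] := free_exists (subxx _) G0.
exists p => //; move: (pG); rewrite inE => /andP[pZ pZ'].
have vis A x : x \in A -> x \notin Z -> x \in visible (Z' :\: Z) A.
  by move=> xA xZ; rewrite /visible setDv setD0 inE xZ.
split.
- move=> A AFA [x [y [z [xy yz]]]]; rewrite !inE !negb_or => /andP[/andP[xp xZ] xA].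
  move=> /andP[yA +] /andP[/andP[zp zZ] zA]; case/predU1P => [yp|yZ]; last first.
    by case: (AZ AFA) => + _; apply; exists x, y, z; rewrite !inE xZ xA yA yZ zA zZ.
  subst y; move/negP: (freeA A AFA); apply; rewrite /blockedA yA.
  by apply/existsP; exists x; apply/existsP; exists z; rewrite xy yz !vis.
- move=> D DFD [x [y [xy]]]; rewrite !inE !negb_or => /andP[xD +] /andP[/andP[yp yZ] yD].
  case/predU1P => [xp|xZ]; last first.
    by case: (DZ DFD) => + _; apply; exists x, y; rewrite !inE xZ xD yD yZ.
  subst x; move/negP: (freeD D DFD); apply; rewrite /blockedD xD.
  apply/existsP; exists y; rewrite xy yD inE yZ /=; apply/negPn/negP => yZ'.
  by case: (DZ DFD) => _; apply; exists p, y; rewrite !inE xD pZ' yZ' yD.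
- move=> B BFB [x [y [xy]]]; rewrite !inE !negb_or => /andP[/andP[xp xZ] xB] /andP[yB].
  case/predU1P => [yp|yZ]; last first.
    by case: (BZ BFB) => + _; apply; exists x, y; rewrite !inE xZ xB yB yZ.
  subst y; move/negP: (freeB B BFB); apply; rewrite /blockedB yB.
  apply/existsP; exists x; rewrite xy xB inE xZ /=; apply/negPn/negP => xZ'.
  by case: (BZ BFB) => _; apply; exists x, p; rewrite !inE yB pZ' xZ' xB.
move=> F FFF [x [y [z [xy yz]]]]; rewrite !inE !negb_or => /andP[xF hx] /andP[/andP[yp yZ] yF] /andP[zF hz].
have ZZ'x t : t \in Z -> t \in Z' by move/(subsetP ZZ').
have yG : y \in Z' :\: Z.
  rewrite inE yZ /=; apply/negPn/negP => yZ'; case: (FZ FFF) => _; apply; exists x, y, z.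
  rewrite !inE xF yF yZ' zF /=; split=> //.
    by case/predU1P: hx => [->|/ZZ'x].
  by case/predU1P: hz => [->|/ZZ'x].
have [nr nl] := freeF F FFF.
case/predU1P: hx => [xp|xZ]; case/predU1P: hz => [zp|zZ].
- by move: xy yz; rewrite xp zp; poslia.
- move/negP: nr; apply; rewrite /blockedFr -xp xF; apply/existsP; exists y; apply/existsP; exists z.
  by rewrite xy yz yF yG inE zF zZ.
- move/negP: nl; apply; rewrite /blockedFl -zp zF; apply/existsP; exists y; apply/existsP; exists x.
  by rewrite xy yz yF yG inE xF xZ.
by case: (FZ FFF) => + _; apply; exists x, y, z; rewrite !inE xF xZ yZ yF zF zZ.
Qed.

End Insertion.

(** * Cubes in a set system *)

Section Cubes.
Variable T : finType.
Implicit Types (C : {set {set T}}) (D S Z U : {set T}) (x : T).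

Definition cube C S Z := [disjoint S & Z] && [forall U : {set T}, (U \subset S) ==> (U :|: Z \in C)].

Lemma cubeP C S Z :
  reflect ([disjoint S & Z] /\ forall U, U \subset S -> U :|: Z \in C) (cube C S Z).
Proof.
apply: (iffP andP) => -[dSZ h]; split=> //; last by apply/forallP => U; apply/implyP/h.
by move=> U US; move/forallP: h => /(_ U); rewrite US.
Qed.

Lemma cube0 C Z : cube C set0 Z = (Z \in C).
Proof.
apply/cubeP/idP => [[_ /(_ set0 (sub0set _))]|ZC]; first by rewrite set0U.
split=> [|U]; first by rewrite -setI_eq0 set0I.
by rewrite subset0 => /eqP ->; rewrite set0U.
Qed.

Lemma cubeU1 C S Z x : x \notin Z -> cube C S Z -> cube C S (x |: Z) -> cube C (x |: S) Z.
Proof.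
move=> xZ /cubeP[dSZ hZ] /cubeP[_ hxZ]; apply/cubeP; split.
  by rewrite disjoints_subset subUset sub1set inE xZ -disjoints_subset.
move=> U; have [xU US|xU] := boolP (x \in U); last first.
  rewrite -subDset => US; apply: hZ; apply: subset_trans US.
  by rewrite subsetD1 subxx.
have -> : U :|: Z = (U :\ x) :|: (x |: Z) by rewrite -{1}(setD1K xU) setUA (setUC [set x]) -setUA.
by apply: hxZ; rewrite subDset.
Qed.

Lemma cube_sub C S S' Z : S' \subset S -> cube C S Z -> cube C S' Z.
Proof.
move=> sub /cubeP[dSZ h]; apply/cubeP; split; first exact: disjointWl dSZ.
by move=> U US; apply/h/(subset_trans US).
Qed.

Lemma cube_face C S Z U : U \subset S -> cube C S Z -> cube C (S :\: U) (U :|: Z).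
Proof.
move=> US /cubeP[dSZ h]; apply/cubeP; split.
  rewrite disjoints_subset setCU subsetI.
  rewrite setDE subsetIr; apply: subset_trans (subsetIl _ _) _.
  by rewrite -disjoints_subset.
move=> V; rewrite subsetD => /andP[VS _]; rewrite setUA; apply: h.
by rewrite subUset VS.
Qed.

(** This is strong shattering; [card_spanned] is the lower half of the sandwich inequality between
    strongly shattered sets, members and shattered sets. *)
Definition spanned C S := [exists Z : {set T}, cube C S Z].

Definition without C x := [set Z in C | x \notin Z].
Definition link C x := [set Z : {set T} | (x \notin Z) && (x |: Z \in C)].

Lemma card_without_link C x : #|C| = #|without C x| + #|link C x|.
Proof.
have -> : #|link C x| = #|[set x |: Z | Z in link C x]|.
  rewrite card_in_imset // => Z Z'; rewrite !inE => /andP[xZ _] /andP[xZ' _] e.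
  by rewrite -(setU1K xZ) e setU1K.
rewrite -cardsUI addnC [_ :&: _](_ : _ = set0) ?cards0; last first.
  apply/setP => Z; rewrite !inE; apply/negP => /andP[/andP[_ xZ] /imsetP[Z' _ eZ]].
  by rewrite eZ setU11 in xZ.
congr #|pred_of_set _|; apply/setP => Z; rewrite !inE.
have [ZC|ZC] /= := boolP (Z \in C).
  have [xZ|//] /= := boolP (x \in Z); apply/esym/imsetP; exists (Z :\ x); last by rewrite setD1K.
  by rewrite !inE eqxx setD1K.
apply/esym/imsetP => -[Z']; rewrite inE => /andP[_ xZC] e.
by rewrite e xZC in ZC.
Qed.

Lemma spanned_without_link C S x : spanned C S ->
  if x \in S then (S :\ x) \in [set U | spanned (without C x) U] :&: [set U | spanned (link C x) U]
  else S \in [set U | spanned (without C x) U] :|: [set U | spanned (link C x) U].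
Proof.
case/existsP => Z /cubeP[dSZ h]; case: ifPn => xS.
  have xZ : x \notin Z by rewrite (disjointFr dSZ xS).
  have dS : [disjoint S :\ x & Z] by apply: disjointWl dSZ; apply: subD1set.
  rewrite !inE; apply/andP; split; apply/existsP; exists Z; apply/cubeP; split=> // U US.
    by rewrite !inE h ?(subset_trans US (subD1set _ _)) // (negbTE xZ) orbF; move: US; rewrite subsetD1 => /andP[].
  rewrite inE setUA h ?subUset ?sub1set ?xS ?(subset_trans US (subD1set _ _)) // !inE (negbTE xZ) orbF andbT.
  by move: US; rewrite subsetD1 => /andP[].
have xU U : U \subset S -> x \notin U by move=> US; apply: contra xS; apply: subsetP.
rewrite !inE; apply/orP; have [xZ|xZ] := boolP (x \in Z); [right | left]; apply/existsP.
  exists (Z :\ x); apply/cubeP; split; first by apply: disjointWr dSZ; apply: subD1set.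
  by move=> U US; rewrite !inE eqxx orbF xU //= setUCA setD1K ?h.
by exists Z; apply/cubeP; split=> // U US; rewrite !inE h // (negbTE xZ) orbF xU.
Qed.

(* A set of directions containing [x] is spanned both in the link of [x] and without [x]. *)
Lemma card_spanned C : #|[set S | spanned C S]| <= #|C|.
Proof.
suff bound D : (forall Z, Z \in C -> Z \subset D) -> #|[set S | spanned C S]| <= #|C|.
  by apply: (bound setT) => Z _; apply: subsetT.
have [k] := ubnP #|D|; elim: k D C => // k IH D C Dk CD.
have [D0|[x xD]] := set_0Vmem D.
  have sub : [set S | spanned C S] \subset C.
    apply/subsetP => S; rewrite inE => /existsP[Z /cubeP[_ h]].
    have := CD _ (h S (subxx _)); rewrite D0 subset0 setU_eq0 => /andP[/eqP S0 /eqP Z0].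
    by have := h S (subxx _); rewrite S0 Z0 setU0.
  exact: subset_leq_card.
have D'k : #|D :\ x| < k by move: Dk; rewrite (cardsD1 x D) xD.
have IH0 : #|[set S | spanned (without C x) S]| <= #|without C x|.
  apply: (IH (D :\ x)) => // Z; rewrite !inE => /andP[/CD ZD xZ].
  by rewrite subsetD1 ZD.
have IH1 : #|[set S | spanned (link C x) S]| <= #|link C x|.
  apply: (IH (D :\ x)) => // Z; rewrite !inE => /andP[xZ /CD ZD].
  by rewrite subsetD1 xZ (subset_trans _ ZD) // subsetUr.
rewrite (card_without_link C x) (leq_trans _ (leq_add IH0 IH1)) // -cardsUI.
rewrite (card_without_link _ x) leq_add //; apply: subset_leq_card; apply/subsetP => S.
  by rewrite inE => /andP[]; rewrite inE => /(spanned_without_link x) + /negbTE xS; rewrite xS.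
rewrite inE => /andP[xS]; rewrite inE => /(spanned_without_link x).
by rewrite setU11 setU1K.
Qed.

End Cubes.

(** * Squares and three-dimensional cubes in a maximal system *)

Section Squares.
Variable m : nat.
Local Notation n := m.+1.
Local Notation res := (@res m).
Implicit Types (E S U V W X Y Z : {set 'I_n}) (x y : 'I_n) (a b c k p q r s t u : nat).

Lemma res_shift p q k : res p = res q -> res (p + k) = res (q + k).
Proof. by move/(congr1 val) => /= e; apply: val_inj; rewrite /= -modnDml e modnDml. Qed.

Lemma res_neq s t : s < t -> t < s + n -> (res s == res t) = false.
Proof. by move=> st ts; apply/eqP => /(@res_inj _ s); lia. Qed.

Lemma res_neqC s t : s < t -> t < s + n -> (res t == res s) = false.
Proof. by move=> st ts; rewrite eq_sym res_neq. Qed.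

Definition interval s e := [set x | shift_rank (res s) x < e - s].

Lemma in_interval s e t : s <= t < s + n -> (res t \in interval s e) = (t < e).
Proof. by move=> h; rewrite inE shift_rank_res //; lia. Qed.

Lemma interval_noncrossing s e X : ~ crossing (interval s e) X.
Proof.
apply: shift_ll_noncrossing (_ : shift_ll (res s) _ _); apply/shift_llP => p q sp pq qs.
by rewrite !inE -!(in_set (fun x => shift_rank (res s) x < e - s)) !in_interval; lia.
Qed.

Lemma interval_consl s e : s < e -> res s |: interval s.+1 e = interval s e.
Proof.
move=> se; apply/setP => x; have [t ht <-] := res_window s x; rewrite in_setU1 (@in_interval s e) //.
have [->|ne] := eqVneq t s; first by rewrite eqxx.
by rewrite res_neqC ?in_interval //; lia.
Qed.

Lemma interval_consr s e : s <= e < s + n -> res e |: interval s e = interval s e.+1.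
Proof.
move=> se; apply/setP => x; have [t ht <-] := res_window s x; rewrite in_setU1 !in_interval //.
have [->|ne] := eqVneq t e; first by rewrite eqxx ltnSn.
have -> : (res t == res e) = false by apply/eqP => /(@res_inj _ s); lia.
by lia.
Qed.

(** The new element must take part in the crossing, and the pattern is rotated to begin with it. *)
Lemma crossing_setU1 X U t : crossing (res t |: X) U -> ~ crossing X U ->
  res t \notin U /\ exists u z v, [/\ t < u, u < z, z < v & v < t + n] /\
    [/\ res u \in U :\: (res t |: X), res z \in X :\: U & res v \in U :\: (res t |: X)].
Proof.
case=> p [q [r [s [[h1 h2 h3 h4] [i1 i2 i3 i4]]]]] nc.
wlog ep : p q r s h1 h2 h3 h4 i1 i2 i3 i4 / res p = res t.
  move=> wl; have [|np] := eqVneq (res p) (res t); first by apply: wl i1 i2 i3 i4.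
  have [er|nr] := eqVneq (res r) (res t).
    by apply: (wl r s (p + n) (q + n)); rewrite ?res_add //; lia.
  case: nc; exists p, q, r, s; split=> //; move: i1 i2 i3 i4.
  by rewrite !inE (negbTE np) (negbTE nr) !negb_or => -> /andP[/andP[_ ->] ->] -> /andP[/andP[_ ->] ->].
have rr : res r != res t by rewrite -ep res_neqC //; lia.
have sh k : p <= k -> res (t + (k - p)) = res k by move=> pk; rewrite -(res_shift _ ep) subnKC.
split; first by move: i1; rewrite -ep inE => /andP[].
exists (t + (q - p)), (t + (r - p)), (t + (s - p)); rewrite !sh; try lia.
split; first by split; lia.
by split=> //; move: i3; rewrite !inE (negbTE rr).
Qed.

(** * The chain of squares in two given directions *)

Variable C : {set {set 'I_n}}.
Hypothesis C_noncrossing : forall U V, U \in C -> V \in C -> ~ crossing U V.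
Hypothesis C_maximal : forall U, (forall V, V \in C -> ~ crossing U V) -> U \in C.

Lemma no_cross U V p q r s : U \in C -> V \in C -> [/\ p < q, q < r, r < s & s < p + n] ->
  res p \in U :\: V -> res q \in V :\: U -> res r \in U :\: V -> res s \in V :\: U -> False.
Proof. by move=> UC VC ? *; apply: (C_noncrossing UC VC); exists p, q, r, s. Qed.

Definition square a b W := cube C [set res a; res b] W.

Lemma squareC a b W : square a b W = square b (a + n) W.
Proof. by rewrite /square res_add setUC. Qed.

Lemma squareP a b W : reflect
  [/\ res a \notin W /\ res b \notin W, W \in C, res a |: W \in C, res b |: W \in C &
      res a |: (res b |: W) \in C] (square a b W).
Proof.
apply: (iffP idP) => [/cubeP[dW h]|[[aW bW] h h1 h2 h3]].
  split; last by rewrite setUA h.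
  - by split; rewrite (disjointFr dW) // !inE eqxx ?orbT.
  - by rewrite -[W]set0U h ?sub0set.
  - by rewrite h ?subsetUl.
  by rewrite h ?subsetUr.
apply/cubeP; split.
  by rewrite disjoints_subset subUset !sub1set !inE aW bW.
move=> U; have [aU|aU] := boolP (res a \in U); have [bU|bU] := boolP (res b \in U) => US.
- suff -> : U = [set res a; res b] by rewrite -setUA.
  by apply/eqP; rewrite eqEsubset US subUset !sub1set aU.
- suff -> : U = [set res a] by [].
  apply/eqP; rewrite eqEsubset sub1set aU andbT; apply/subsetP => x xU.
  move: (subsetP US x xU); rewrite !inE => /orP[//|/eqP xb]; by rewrite -xb xU in bU.
- suff -> : U = [set res b] by [].
  apply/eqP; rewrite eqEsubset sub1set bU andbT; apply/subsetP => x xU.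
  move: (subsetP US x xU); rewrite !inE => /orP[/eqP xb|//]; by rewrite -xb xU in aU.
suff -> : U = set0 by rewrite set0U.
apply/eqP; rewrite -subset0; apply/subsetP => x xU.
move: (subsetP US x xU); rewrite !inE => /orP[]/eqP xb; by [rewrite -xb xU in aU | rewrite -xb xU in bU].
Qed.

Lemma square_interval a b : a < b < a + n -> square a b (interval b.+1 (a + n)).
Proof.
move=> ab; have inC s e : interval s e \in C by apply: C_maximal => V _; apply: interval_noncrossing.
have ea : res a = res (a + n) by rewrite res_add.
have eb : res b = res (b + n) by rewrite res_add.
apply/squareP; split.
- by rewrite ea eb !in_interval; [split|..]; poslia.
- exact: inC.
- by rewrite ea interval_consr ?inC //; poslia.
- by rewrite interval_consl ?inC //; poslia.
by rewrite interval_consl ?ea ?interval_consr ?inC //; lia.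
Qed.

(* On squares in directions [a] and [b], inclusion of the flips is the order that grows on the arc
   from [a] to [b] and shrinks on the arc from [b] to [a]. *)
Definition flip a b X := (X :&: interval a.+1 b) :|: (interval b.+1 (a + n) :\: X).

Lemma in_flipl a b t X : a < t < b -> b < a + n -> (res t \in flip a b X) = (res t \in X).
Proof.
move=> tab ab; rewrite in_setU in_setI in_setD in_interval; last by lia.
have -> : res t \in interval b.+1 (a + n) = false by rewrite -res_add in_interval; lia.
have -> : t < b by lia.
by rewrite andbT andbF orbF.
Qed.

Lemma in_flipr a b t X : a < b -> b < t < a + n -> (res t \in flip a b X) = (res t \notin X).
Proof.
move=> ab tab; rewrite in_setU in_setI in_setD !in_interval; try by lia.
have -> : t < b = false by lia.
have -> : t < a + n by lia.
by rewrite andbF andbT.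
Qed.

Lemma flipP a b x X : a < b < a + n -> x \in flip a b X ->
  exists2 t, x = res t & a < t < b /\ res t \in X \/ b < t < a + n /\ res t \notin X.
Proof.
move=> ab; have [t ht <-] := res_window a x => tX; exists t => //.
have [ta|at'] := eqVneq t a.
  move: tX; rewrite ta in_setU in_setI in_setD -[res a]res_add !in_interval; lia.
have [tb|tb] := ltnP t b.
  by left; rewrite in_flipl in tX; lia.
have [ta|tb'] := eqVneq t b; last by right; rewrite in_flipr in tX; lia.
move: tX; rewrite ta in_setU in_setI in_setD in_interval ?ltnn ?andbF; last by lia.
by rewrite -[res b]res_add in_interval; lia.
Qed.

Lemma square_notin a b t X : a < b < a + n -> square a b X -> res t \in X ->
  (res t == res a) = false /\ (res t == res b) = false.
Proof.
move=> ab /squareP[[aX bX] _ _ _ _] tX.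
by split; apply/negP => /eqP e; rewrite -e tX in aX bX.
Qed.

(** The squares supply the two missing positions: [res b |: X] and [res a |: Y] cross at [x], [y],
    [b], [a] when [x] comes first. *)
Lemma square_arc a b X Y (x y : nat) : a < b < a + n -> square a b X -> square a b Y ->
  a < x < b -> a < y < b -> res x \in X :\: Y -> res y \in Y :\: X -> False.
Proof.
wlog xy : X Y x y / x < y.
  move=> wl ab sX sY hx hy xX yY; have [xy|yx|e] := ltngtP x y.
  - exact: (wl X Y x y).
  - exact: (wl Y X y x).
  by move: xX yY; rewrite e !inE => /andP[_ ->].
move=> ab /squareP[[aX bX] _ _ bXC _] /squareP[[aY bY] _ aYC _ _] hx hy.
rewrite !inE => /andP[xY xX] /andP[yX yY].
have e k : a < k < b -> (res k == res a) = false /\ (res k == res b) = false.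
  by move=> h; rewrite res_neqC ?res_neq //; poslia.
have [[ex1 ex2] [ey1 ey2]] := (e x hx, e y hy).
apply: (@no_cross (res b |: X) (res a |: Y) x y b (a + n)) => //; rewrite ?res_add ?inE; first by split; poslia.
- by rewrite ex1 ex2 xX xY.
- by rewrite ey1 ey2 yX yY.
- by rewrite eqxx (negbTE bY) res_neqC //; poslia.
by rewrite eqxx (negbTE aX) res_neq //; poslia.
Qed.

(** Incomparable flips provide two positions. On the same arc [square_arc] applies; on different
    arcs the bottom of one square crosses the top of the other at these positions and [a], [b]. *)
Lemma square_comparable a b X Y : a < b < a + n -> square a b X -> square a b Y ->
  flip a b X \subset flip a b Y \/ flip a b Y \subset flip a b X.
Proof.
move=> ab sX sY; apply/orP; rewrite -[_ || _]negbK negb_or; apply/negP => /andP[].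
move=> /subsetPn[x xX xY] /subsetPn[y yY yX].
have wl X' Y' (x' y' : nat) : square a b X' -> square a b Y' -> a < x' < b -> b < y' < a + n ->
    res x' \in X' :\: Y' -> res y' \in X' :\: Y' -> False.
  move=> sX' sY' hx hy xX' yX'; have [[aX1 bX1] XC _ _ _] := squareP _ _ _ sX'.
  have [[aY1 bY1] _ _ _ YC] := squareP _ _ _ sY'.
  have e t : res t \in X' :\: Y' -> (res t == res a) = false /\ (res t == res b) = false.
    by rewrite inE => /andP[_ tX]; apply: square_notin sX' tX.
  have [[ex1 ex2] [ey1 ey2]] := (e x' xX', e y' yX').
  apply: (@no_cross (res a |: (res b |: Y')) X' a x' b y') => //;
    first (by split; poslia); move: xX' yX'; rewrite !inE.
  - by rewrite eqxx aX1.
  - by rewrite ex1 ex2.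
  - by rewrite eqxx bX1 orbT.
  by rewrite ey1 ey2.
have [t ex ht] := flipP ab xX; have [s ey hs] := flipP ab yY; subst x y.
case: ht hs => -[ht tX] [[hs sY']|[hs sY']].
- apply: (@square_arc a b X Y t s) => //; rewrite inE ?tX ?sY' andbT.
    by move: xY; rewrite in_flipl //; poslia.
  by move: yX; rewrite in_flipl //; poslia.
- apply: (wl X Y t s) => //; rewrite inE ?tX ?(negbTE sY') ?andbT /=.
    by move: xY; rewrite in_flipl //; poslia.
  by move: yX; rewrite in_flipr ?negbK //; poslia.
- apply: (wl Y X s t) => //; rewrite inE ?sY' ?(negbTE tX) ?andbT /=.
    by move: yX; rewrite in_flipl //; poslia.
  by move: xY; rewrite in_flipr ?negbK //; poslia.
apply: (@square_arc b (a + n) X Y s t) => //; rewrite -?squareC // ?inE ?(negbTE tX) ?(negbTE sY') /=; try poslia.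
  by move: yX; rewrite in_flipr ?negbK //; poslia.
by move: xY; rewrite in_flipr ?negbK //; poslia.
Qed.

(** * Adding one element to a square *)

Section Insert.
Variables a b : nat.
Hypothesis ab : a < b < a + n.
Local Notation K := (b - a.+1).

Definition pos (x : 'I_K) := res (a.+1 + x).
Definition trace U := [set x | pos x \in U].

Lemma pos_neq (x : 'I_K) : (pos x == res a) = false /\ (pos x == res b) = false.
Proof. by have := ltn_ord x => xK; rewrite res_neqC ?res_neq //; poslia. Qed.

Lemma pos_exists t : a < t < b -> exists2 x : 'I_K, a.+1 + x = t & pos x = res t.
Proof.
move=> h; have lt : t - a.+1 < K by poslia.
exists (Ordinal lt); first by rewrite /= subnKC //; poslia.
by rewrite /pos /= subnKC //; poslia.
Qed.

Lemma in_traceD (x : 'I_K) U V : (x \in trace U :\: trace V) = (pos x \in U :\: V).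
Proof. by rewrite !inE. Qed.

Lemma trace_surrounds U V t (x y z : 'I_K) : U \in C -> V \in C -> x < y -> y < z ->
  t = a \/ t = b -> x \in trace U :\: trace V -> y \in trace V :\: trace U -> z \in trace U :\: trace V ->
  res t \in V :\: U -> False.
Proof.
rewrite !in_traceD => UC VC xy yz ht xU yV zU tV; have zK := ltn_ord z.
case: ht tV => -> tV.
  apply: (no_cross UC VC _ xU yV zU (_ : res (a + n) \in _)); last by rewrite res_add.
  by split; poslia.
by apply: (no_cross UC VC _ xU yV zU tV); split; poslia.
Qed.

Lemma trace_inversion U V (x y : 'I_K) : U \in C -> V \in C -> x < y ->
  x \in trace U :\: trace V -> y \in trace V :\: trace U ->
  res b \in U :\: V -> res a \in V :\: U -> False.
Proof.
rewrite !in_traceD => UC VC xy xU yV bU aV; have yK := ltn_ord y.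
apply: (no_cross UC VC _ xU yV bU (_ : res (a + n) \in _)); last by rewrite res_add.
by split; poslia.
Qed.

Lemma trace_alternates U V : U \in C -> V \in C -> ~ alternates (trace U) (trace V).
Proof.
move=> UC VC [x [y [z [t [[xy yz zt] []]]]]]; rewrite !in_traceD => xU yV zU tV.
have tK := ltn_ord t; apply: (no_cross UC VC _ xU yV zU tV); split; poslia.
Qed.

Lemma trace_setU1 t U : t = a \/ t = b -> trace (res t |: U) = trace U.
Proof.
move=> ht; apply/setP => x; rewrite !inE; have [ea eb] := pos_neq x.
by case: ht => ->; rewrite ?ea ?eb.
Qed.

Lemma square_trace W U : square a b W -> U \in C ->
  [/\ res a \notin U -> res b \notin U -> ~ surrounds (trace U) (trace W),
      res a \in U -> res b \in U -> ~ surrounds (trace W) (trace U),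
      res a \in U -> res b \notin U -> ~ inversion (trace W) (trace U) &
      res a \notin U -> res b \in U -> ~ inversion (trace U) (trace W)].
Proof.
case/squareP => -[aW bW] WC aWC bWC abWC UC.
have [ta tb] := (@trace_setU1 a W (or_introl erefl), @trace_setU1 b W (or_intror erefl)).
have nab : (res a == res b) = false by rewrite res_neq //; poslia.
split=> aU bU [x [y]].
- case=> z [xy yz]; rewrite -tb => xU yW zU.
  by apply: (trace_surrounds UC bWC xy yz (or_intror erefl) xU yW zU); rewrite !inE eqxx bU.
- case=> z [xy yz] xU yW zU.
  by apply: (trace_surrounds WC UC xy yz (or_intror erefl) xU yW zU); rewrite inE bU bW.
- rewrite -tb => -[xy xW yU].
  by apply: (trace_inversion bWC UC xy xW yU); rewrite !inE ?eqxx ?bU ?aU ?nab ?(negbTE aW).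
rewrite -ta => -[xy xU yW].
by apply: (trace_inversion UC aWC xy xU yW); rewrite !inE ?eqxx ?bU ?aU // eq_sym nab (negbTE bW).
Qed.

(** By maximality the enlarged corners only have to cross no member [U]. A crossing is reduced to a
    pattern on the arc that [insertion] excludes; the agreement of [W] and [W'] on the other arc
    serves the case where [U] contains both [a] and [b]. *)
Lemma square_insert W W' : square a b W -> square a b W' ->
  (forall t, a < t < b -> res t \in W -> res t \in W') ->
  (forall t, b < t < a + n -> (res t \in W) = (res t \in W')) ->
  (exists2 t, a < t < b & res t \in W' :\: W) ->
  exists2 t, a < t < b & res t \in W' :\: W /\ square a b (res t |: W).
Proof.
move=> sW sW' sub1 eq2 [t0 ht0 t0W].
pose F (f g : bool) := [set trace U | U in C & ((res a \in U) == f) && ((res b \in U) == g)].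
have inF f g U : U \in C -> (res a \in U) = f -> (res b \in U) = g -> trace U \in F f g.
  by move=> UC <- <-; apply: imset_f; rewrite inE UC !eqxx.
have Fin f g A : A \in F f g -> exists U, [/\ A = trace U, U \in C, (res a \in U) = f & (res b \in U) = g].
  by case/imsetP => U; rewrite inE => /and3P[UC /eqP <- /eqP <-] ->; exists U.
have subW : trace W \subset trace W'.
  apply/subsetP => x; rewrite !inE; have := ltn_ord x => xK; apply: sub1; poslia.
have neqW : trace W != trace W'.
  have [x _ ex] := pos_exists ht0; apply: contraTneq t0W => eW.
  by rewrite -ex -in_traceD eW !inE andNb.
have surr f g f' g' A B : A \in F f g -> B \in F f' g' -> (f < f') || (g < g') -> ~ surrounds A B.
  move=> /Fin[U [-> UC eUa eUb]] /Fin[V [-> VC eVa eVb]] lt [x [y [z [xy yz xU yV zU]]]].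
  have [t ht tV] : exists2 t, t = a \/ t = b & res t \in V :\: U.
    case/orP: lt => lt; [exists a | exists b]; auto; rewrite inE ?eUa ?eUb ?eVa ?eVb.
      by move: lt; case: (f); case: (f').
    by move: lt; case: (g); case: (g').
  exact: (trace_surrounds UC VC xy yz ht xU yV zU tV).
have alt f g A A' : A \in F f g -> A' \in F f g -> ~ alternates A A'.
  by move=> /Fin[U [-> UC _ _]] /Fin[V [-> VC _ _]]; apply: trace_alternates.
have [||||||||||||||p pW [nA nD nB nF]] :=
  @insertion _ (F false false) (F false true) (F true false) (F true true) (trace W) (trace W').
- move=> _ /Fin[U [-> UC aU bU]]; have [+ _ _ _] := square_trace sW UC; have [+ _ _ _] := square_trace sW' UC.
  by rewrite aU bU; auto.
- move=> _ /Fin[U [-> UC aU bU]]; have [_ + _ _] := square_trace sW UC; have [_ + _ _] := square_trace sW' UC.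
  by rewrite aU bU; auto.
- move=> _ /Fin[U [-> UC aU bU]]; have [_ _ + _] := square_trace sW UC; have [_ _ + _] := square_trace sW' UC.
  by rewrite aU bU; auto.
- move=> _ /Fin[U [-> UC aU bU]]; have [_ _ _ +] := square_trace sW UC; have [_ _ _ +] := square_trace sW' UC.
  by rewrite aU bU; auto.
- exact: alt.
- exact: alt.
- by move=> A B AF BF; apply: (surr _ _ _ _ _ _ AF BF).
- by move=> A B AF BF; apply: (surr _ _ _ _ _ _ AF BF).
- by move=> A B AF BF; apply: (surr _ _ _ _ _ _ AF BF).
- by move=> A B AF BF; apply: (surr _ _ _ _ _ _ AF BF).
- by move=> A B AF BF; apply: (surr _ _ _ _ _ _ AF BF).
- move=> _ _ /Fin[U [-> UC aU bU]] /Fin[V [-> VC aV bV]] [x [y [xy xU yV]]].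
  by apply: (trace_inversion UC VC xy xU yV); rewrite inE ?aU ?bU ?aV ?bV.
- exact: subW.
- exact: neqW.
have pK := ltn_ord p; have htp : a < a.+1 + p < b by poslia.
have tW : pos p \in W' :\: W by rewrite -in_traceD.
exists (a.+1 + p) => //; split=> //; rewrite -/(pos p).
have [ea eb] := pos_neq p.
move Et: (a.+1 + p) htp => t htp.
have pt : pos p = res t by rewrite /pos Et.
rewrite pt in tW ea eb *.
have [[aW bW] _ _ _ _] := squareP _ _ _ sW; have [[aW' bW'] WC' _ _ _] := squareP _ _ _ sW'.
have [_ cubeW] := cubeP _ _ _ sW.
apply/cubeP; split.
  by rewrite disjoints_subset subUset !sub1set !inE !negb_or aW bW eq_sym ea eq_sym eb.
move=> E Eab; rewrite setUCA; set V := E :|: W.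
have VC : V \in C by apply: cubeW.
have aVC : res a |: V \in C by rewrite setUA; apply: cubeW; rewrite subUset Eab sub1set !inE eqxx.
have bVC : res b |: V \in C by rewrite setUA; apply: cubeW; rewrite subUset Eab sub1set !inE eqxx orbT.
apply: C_maximal => U UC cr.
have [tU [u [z [v [[tu uz zv vt] [uU zV vU]]]]]] := crossing_setU1 cr (C_noncrossing VC UC).
have sub_ x : x \in U :\: (res t |: V) -> x \in U :\: V.
  by rewrite !inE negb_or => /andP[/andP[_ ->] ->].
have sub_c c x : res c \notin U -> x \in U :\: V -> x \in U :\: (res c |: V).
  move=> cU; rewrite !in_setD in_setU1 negb_or => /andP[-> xU].
  by rewrite xU !andbT; apply: contraNneq cU => <-.
have sub_z c x : x \in V :\: U -> x \in (res c |: V) :\: U.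
  by rewrite !in_setD in_setU1 => /andP[-> ->]; rewrite orbT.
(* If [U] misses [b], then [b] could replace [t] in the crossing unless [u] comes before [b]. The
   same holds for [a] and [v], so both witnesses are pulled onto the arc. *)
have ub : res b \notin U -> u < b.
  move=> bU; rewrite ltnNge; apply/negP => bu.
  have bu' : b < u.
    by rewrite ltn_neqAle bu andbT; apply: contraNneq bU => ->; move: uU; rewrite inE => /andP[].
  apply: (no_cross bVC UC (_ : [/\ b < u, u < z, z < v & v < b + n])); first by split; poslia.
  - by rewrite !inE bU eqxx.
  - exact/sub_c/sub_.
  - exact: sub_z.
  exact/sub_c/sub_.
have va : res a \notin U -> a + n < v.
  move=> aU; rewrite ltnNge; apply/negP => va.
  have va' : v < a + n.
    rewrite ltn_neqAle va andbT; apply: contraNneq aU => e; rewrite -res_add -e.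
    by move: vU; rewrite inE => /andP[].
  apply: (no_cross UC aVC (_ : [/\ u < z, z < v, v < a + n & a + n < u + n])); first by split; poslia.
  - exact/sub_c/sub_.
  - exact: sub_z.
  - exact/sub_c/sub_.
  by rewrite res_add !inE aU eqxx.
have inU (x : 'I_K) k : pos x = res k -> res k \in U :\: (res t |: V) -> x \in trace U :\: (p |: trace W).
  move=> e; rewrite -e !inE !negb_or => /andP[/andP[xt /andP[_ ->]] ->]; rewrite !andbT.
  by apply: contraNneq xt => ->; rewrite pt.
have pU : p \in (p |: trace W) :\: trace U by rewrite !inE eqxx pt tU.
have wu : res b \notin U -> exists2 x : 'I_K, p < x & x \in trace U :\: (p |: trace W).
  move=> bU; have [|x ex px] := @pos_exists u; first by have := ub bU; poslia.
  by exists x; [poslia | apply: inU px uU].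
have wv : res a \notin U -> exists2 x : 'I_K, x < p & x \in trace U :\: (p |: trace W).
  move=> aU; have av := va aU; have [|x ex px] := @pos_exists (v - n); first by poslia.
  have vn : n <= v by poslia.
  by exists x; [poslia | apply: inU vU; rewrite px -[LHS]res_add subnK].
have tr := inF _ _ U UC erefl erefl.
have [aU|aU] := boolP (res a \in U); have [bU|bU] := boolP (res b \in U);
  rewrite ?aU ?bU ?(negbTE aU) ?(negbTE bU) in tr.
(* With [a] and [b] in [U], the place of [z] decides. On the arc, [p |: trace W] surrounds
   [trace U]; on the other arc [z] is also in [W'], which then crosses [U] at [t], [b], [z], [a]. *)
- have zW : res z \in W :\: U.
    move: zV; rewrite !inE => /andP[zU /orP[/(subsetP Eab)|->]]; last by rewrite zU.
    by rewrite !inE => /orP[]/eqP e; rewrite e ?aU ?bU in zU.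
  have inW (x : 'I_K) k : pos x = res k -> res k \in W :\: U -> x \in (p |: trace W) :\: trace U.
    by move=> e; rewrite -e !inE => /andP[-> ->]; rewrite orbT.
  have zb : z != b by apply: contraTneq zW => ->; rewrite inE bU.
  have za : z != a + n by apply: contraTneq zW => ->; rewrite res_add inE aU.
  have [zb'|bz] := ltnP z b.
    have [|x ex px] := @pos_exists z; first by poslia.
    have [|y ey py] := @pos_exists u; first by poslia.
    apply: (nF _ tr); exists p, y, x; split; [poslia | poslia | exact: pU | exact: inU py uU | exact: inW px zW].
  have {}bz : b < z by rewrite ltn_neqAle eq_sym zb.
  have [za'|az] := ltnP z (a + n).
    apply: (no_cross WC' UC (_ : [/\ t < b, b < z, z < a + n & a + n < t + n])); first by split; poslia.
    + by move: tW; rewrite !inE => /andP[_ ->]; rewrite tU.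
    + by rewrite inE bU bW'.
    + by move: zW; rewrite !inE eq2 //; poslia.
    by rewrite res_add inE aU aW'.
  have {}az : a + n < z by rewrite ltn_neqAle eq_sym za.
  have [|x ex px] := @pos_exists (z - n); first by poslia.
  have [|y ey py] := @pos_exists (v - n); first by poslia.
  have [zn vn] : n <= z /\ n <= v by split; poslia.
  apply: (nF _ tr); exists x, y, p; split; [poslia | poslia | | | exact: pU].
    by apply: inW zW; rewrite px -[LHS]res_add subnK.
  by apply: inU vU; rewrite py -[LHS]res_add subnK.
- by have [x px xU] := wu bU; apply: (nD _ tr); exists p, x.
- by have [x px xU] := wv aU; apply: (nB _ tr); exists x, p.
by have [[x px xU] [y py yU]] := (wu bU, wv aU); apply: (nA _ tr); exists y, p, x.
Qed.

End Insert.

(** * Cubes in three directions *)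

Lemma flip_lt a b x X Y : a < b < a + n -> square a b X -> square a b Y ->
  x \notin flip a b X -> x \in flip a b Y -> flip a b X \proper flip a b Y.
Proof.
move=> ab sX sY xX xY; rewrite properE; apply/andP; split; last by apply/subsetPn; exists x.
by have [//|/subsetP/(_ x xY)] := square_comparable ab sX sY; rewrite (negbTE xX).
Qed.

(* Induction on the arc from [b] to [a]. For [c] on the arc from [a] to [b], the last square without
   [c] and the first square with [c] agree on the other arc, so inserting one element takes the
   former to the latter. *)
Lemma spanned_triple a b c : a < b < a + n -> a < c < a + n -> c != b ->
  spanned C (res c |: [set res a; res b]).
Proof.
have [k] := ubnP (a + n - b); elim: k a b c => // k IH a b c abk ab ac cb.
have right d : b < d < a + n -> spanned C (res d |: [set res a; res b]).
  (* For the directions [d] and [b] the second arc runs from [b] to [d] and is shorter, so induction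
     applies, with [a] as third direction. *)
  move=> bd; have : spanned C (res (a + n) |: [set res d; res (b + n)]) by apply: IH; poslia.
  by rewrite !res_add setUCA.
have [cb'|bc] := ltnP c b; last by apply: right; poslia.
have {ac} ac : a < c < b by poslia.
have exW : square a b (interval b.+1 (a + n)) && (res c \notin interval b.+1 (a + n)).
  by rewrite square_interval // -res_add in_interval -?leqNgt; poslia.
have exW' : square a b (interval (a + n).+1 (b + n)) && (res c \in interval (a + n).+1 (b + n)).
  by rewrite squareC square_interval ?[res c](esym (res_add _ _)) ?in_interval; poslia.
case: (@arg_maxnP _ _ (fun W => square a b W && (res c \notin W)) (fun W => #|flip a b W|) exW)
  => W /andP[sW cW] Wmax.
case: (@arg_minnP _ _ (fun W => square a b W && (res c \in W)) (fun W => #|flip a b W|) exW')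
  => W' /andP[sW' cW'] W'min.
have ab' : b < a + n by poslia.
have sub : flip a b W \subset flip a b W'.
  by apply/proper_sub/(@flip_lt _ _ (res c)) => //; rewrite in_flipl.
(* A cube in directions [a], [b], [t] with bottom [Z] gives two squares: [Z] comes after [W] and
   [res t |: Z] before [W']. If [c] is not in [Z], the first contradicts the choice of [W];
   otherwise the second contradicts that of [W']. *)
have flat t : b < t < a + n -> res t \in W -> res t \notin W' -> False.
  move=> ht tW tW'; have [Z cZ] := existsP (right t ht).
  have tab : res t \notin [set res a; res b].
    by rewrite !inE res_neqC ?res_neqC //; poslia.
  have tZ : res t \notin Z by have [dS _] := cubeP _ _ _ cZ; rewrite (disjointFr dS) // setU11.
  have sZ : square a b Z by apply: cube_sub cZ; apply: subsetU1.
  have stZ : square a b (res t |: Z).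
    by rewrite /square -(setU1K tab); apply: cube_face cZ; rewrite sub1set setU11.
  have fl X : (res t \in flip a b X) = (res t \notin X) by apply: in_flipr => //; poslia.
  have [cZ'|cZ'] := boolP (res c \in Z).
    have := W'min (res t |: Z); rewrite stZ in_setU1 cZ' orbT => /(_ isT).
    rewrite leqNgt => /negP; apply; apply: proper_card; apply: (@flip_lt _ _ (res t)) => //.
      by rewrite fl // setU11.
    by rewrite fl.
  have := Wmax Z; rewrite sZ cZ' => /(_ isT).
  rewrite /= leqNgt => /negP; apply; apply: proper_card; apply: (@flip_lt _ _ (res t)) => //.
    by rewrite fl // tW.
  by rewrite fl.
have [|||p hp [pW spW]] := square_insert ab sW sW'.
- by move=> t ht tW; have := subsetP sub (res t); rewrite !in_flipl //; apply.
- move=> t ht; have := subsetP sub (res t); rewrite !in_flipr; try poslia.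
  have [tW _|tW] := boolP (res t \in W); last by move/(_ isT)/negbTE.
  by apply/esym/negPn/negP; apply: flat ht tW.
- by exists c; rewrite // inE cW cW'.
have [pW' pW1] : res p \in W' /\ res p \notin W by move: pW; rewrite inE => /andP[].
(* An inserted element other than [c] would give a later square without [c]. *)
have [cp|cp] := boolP (res c \in res p |: W).
  move: cp; rewrite in_setU1 (negbTE cW) orbF => /eqP ecp.
  by apply/existsP; exists W; apply: cubeU1 => //; rewrite ecp.
have := Wmax (res p |: W); rewrite spW cp => /(_ isT).
rewrite /= leqNgt => /negP; case; apply: proper_card; apply: (@flip_lt _ _ (res p)) => //.
  by rewrite in_flipl.
by rewrite in_flipl // setU11.
Qed.

Lemma set0_noncrossing U : ~ crossing set0 U.
Proof. by case=> p [q [r [s [_ []]]]]; rewrite !inE andbF. Qed.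

Lemma set1_noncrossing x U : ~ crossing [set x] U.
Proof.
case=> p [q [r [s [[pq qr rs sp] []]]]]; rewrite !inE => /andP[_ /eqP ep] _ /andP[_ /eqP er] _.
by have := @res_neq p r; rewrite ep er eqxx; poslia.
Qed.

Lemma spanned_le3 S : #|S| <= 3 -> spanned C S.
Proof.
have C0 : set0 \in C by apply: C_maximal => V _; apply: set0_noncrossing.
have [->|[x xS]] := set_0Vmem S; first by move=> _; apply/existsP; exists set0; rewrite cube0.
rewrite -(setD1K xS) cardsU1 setD11 ltnS; have [->|[y yS]] := set_0Vmem (S :\ x).
  move=> _; apply/existsP; exists set0; apply: cubeU1; rewrite ?inE ?cube0 ?setU0 //.
  by apply: C_maximal => V _; apply: set1_noncrossing.
have nxy : x != y by move: yS; rewrite !inE eq_sym => /andP[].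
have [b hb eb] := res_window x y.
have xb : x < b < x + n.
  by have : b != x by [apply: contraNneq nxy => e; rewrite -eb e res_val]; poslia.
rewrite -(setD1K yS) cardsU1 setD11 ltnS; have [->|[z zS]] := set_0Vmem (S :\ x :\ y).
  move=> _; rewrite setU0; apply/existsP; exists (interval b.+1 (x + n)).
  by have := square_interval xb; rewrite /square res_val eb.
rewrite (cardsD1 z) zS ltnS leqn0 cards_eq0 => /eqP e.
have -> : S :\ x :\ y = [set z] by rewrite -(setD1K zS) e setU0.
have [c hc ec] := res_window x z.
have [zx zy] : z != x /\ z != y by move: zS; rewrite !inE => /and3P[-> ->].
have cx : c != x by apply: contraNneq zx => e'; rewrite -ec e' res_val.
have cb : c != b by apply: contraNneq zy => e'; rewrite -ec e' eb.
have := @spanned_triple x b c xb; rewrite res_val eb ec => /(_ _ cb).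
have -> : x |: (y |: [set z]) = z |: [set x; y] by rewrite setUA setUC.
by apply; poslia.
Qed.

Lemma maximal_card : #|[set S : {set 'I_n} | #|S| <= 3]| <= #|C|.
Proof.
apply: leq_trans (card_spanned C); apply/subset_leq_card/subsetP => S; rewrite !inE.
exact: spanned_le3.
Qed.

End Squares.

(** * The bound on one level *)

Section LevelBound.
Variables (m r : nat) (W : {set {set 'I_m.+1}}).
Local Notation n := m.+1.
Local Notation res := (@res m).
Implicit Types (X Y Z : {set 'I_n}) (k : nat).
Hypotheses (W_noncrossing : forall X Y, X \in W -> Y \in W -> ~ crossing X Y)
  (W_level : forall X, X \in W -> #|X| = r) (r_le : r <= n).

Definition truncate k X := [set x in X | x < k].
Definition truncations k := [set truncate k X | X in W].

Lemma truncateS (x : 'I_n) X : truncate x.+1 X = if x \in X then x |: truncate x X else truncate x X.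
Proof.
apply/setP => y; rewrite !inE ltnS leq_eqVlt -[val y == _]/(y == x).
case: ifPn => xX; rewrite ?inE andb_orr.
  by congr (_ || _); have [->|//] := eqVneq y x; rewrite ?xX ?andbF.
by have [->|//] := eqVneq y x; rewrite ?(negbTE xX) ?andbF.
Qed.

Lemma truncate_notin (x : 'I_n) X : x \notin truncate x X.
Proof. by rewrite inE ltnn andbF. Qed.

(** The sets without [x] and those in the link of [x] are all truncations at [x]; counted
    separately, exactly the [Z] paired with [x |: Z] occur twice. *)
Lemma card_truncationsS (x : 'I_n) :
  #|truncations x.+1| <= #|truncations x| + #|link (truncations x.+1) x :&: without (truncations x.+1) x|.
Proof.
rewrite (card_without_link _ x) [leqLHS]addnC -[leqLHS]cardsUI leq_add2r; apply/subset_leq_card/subsetP => Z.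
rewrite !inE => /orP[/andP[xZ]|/andP[]] /imsetP[X XW].
  rewrite truncateS; case: ifPn => xX eZ; last by have := truncate_notin x X; rewrite -eZ setU11.
  apply/imsetP; exists X => //.
  by rewrite -(setU1K xZ) eZ setU1K // truncate_notin.
rewrite truncateS; case: ifPn => [xX ->|xX -> _]; first by rewrite setU11.
exact: imset_f.
Qed.

Lemma card_truncate_gt (x : 'I_n) X : #|X| <= #|truncate x.+1 X| + (n - x.+1).
Proof.
have -> : n - x.+1 = #|[set y : 'I_n | x < y]|.
  rewrite -[LHS]muln1 -sum_nat_const_nat (big_nat_widenl x.+1 0) // big_mkord -sum1_card.
  by apply: eq_bigl => y; rewrite inE.
rewrite -cardsUI (leq_trans _ (leq_addr _ _)) //; apply/subset_leq_card/subsetP => y yX.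
by rewrite !inE yX ltnS leqNgt /=; case: (x < y).
Qed.

(** Of the three inequalities, [s < r] holds because [x |: Z] lies in a member, [s <= x] because [Z]
    lies below [x], and the last because a member truncated to [Z] has [r - s] elements beyond
    [x]. *)
Lemma card_link_size (x : 'I_n) s :
  #|[set Z in link (truncations x.+1) x :&: without (truncations x.+1) x | #|Z| == s]|
    <= ((s < r) && (s <= x < s + (n - r))).
Proof.
set L := finset _; have [->|[Z ZL]] := set_0Vmem L; first by rewrite cards0.
have unpack Z1 : Z1 \in L -> [/\ #|Z1| = s, exists2 X, X \in W & truncate x.+1 X = x |: Z1 &
    exists2 X, X \in W & truncate x.+1 X = Z1].
  by rewrite !inE => /andP[/andP[/andP[_ /imsetP[X XW ->]] /andP[/imsetP[Y YW ->] _]] /eqP ->];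
    split=> //; [exists X | exists Y].
have below Z1 : Z1 \in L -> [/\ s < r, s <= x & x < s + (n - r)].
  move=> Z1L; have xZ1 : x \notin Z1 by move: Z1L; rewrite !inE => /andP[/andP[/andP[]]].
  have [eZ1 [X XW eX] [Y YW eY]] := unpack Z1 Z1L; split.
  - have /subset_leq_card : x |: Z1 \subset X by rewrite -eX; apply/subsetP => y; rewrite inE => /andP[].
    by rewrite cardsU1 xZ1 eZ1 W_level.
  - have xE : #|[set y : 'I_n | y < x]| = x.
      rewrite -sum1_card -[RHS]subn0 -[RHS]muln1 -sum_nat_const_nat big_mkord.
      rewrite (big_ord_widen n (fun=> 1)) 1?ltnW //.
      by apply: eq_bigl => y; rewrite inE.
    rewrite -eZ1 -[leqRHS]xE; apply/subset_leq_card/subsetP => y yZ1; rewrite inE ltn_neqAle.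
    apply/andP; split; first by apply: contraNneq xZ1 => /val_inj <-.
    by move: yZ1; rewrite -eY inE => /andP[].
  by have := card_truncate_gt x Y; rewrite eY eZ1 W_level //; have := ltn_ord x; poslia.
have [-> -> ->] := below Z ZL.
apply/card_le1_eqP => Z1 Z2 Z1L Z2L; apply/eqP/negPn/negP => ne.
have [e1 X1 X2] := unpack Z1 Z1L; have [e2 Y1 Y2] := unpack Z2 Z2L.
(* Up to [x], [P] has one element more than [Q]; as their sizes agree, [Q] has an element [y] beyond
   [x] outside [P], and they cross at [z], [z'], [x], [y]. *)
have order Z3 Z4 (z z' : 'I_n) : #|Z3| = s -> #|Z4| = s -> x \notin Z3 -> (forall y, y \in Z4 -> y < x) ->
    (exists2 X, X \in W & truncate x.+1 X = x |: Z3) ->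
    (exists2 X, X \in W & truncate x.+1 X = Z4) ->
    z \in Z3 :\: Z4 -> z' \in Z4 :\: Z3 -> z < z' -> False.
  move=> c3 c4 xZ3 Z4x [P PW eP] [Q QW eQ] zZ z'Z zz'.
  have inP (y : 'I_n) : y <= x -> (y \in P) = (y \in x |: Z3) by rewrite -eP inE ltnS => ->; rewrite andbT.
  have inQ (y : 'I_n) : y <= x -> (y \in Q) = (y \in Z4) by rewrite -eQ inE ltnS => ->; rewrite andbT.
  have z'x : z' < x by apply: Z4x; move: z'Z; rewrite inE => /andP[].
  have xZ4 : x \notin Z4 by apply/negP => /Z4x; rewrite ltnn.
  have subP V : truncate x.+1 V \subset V by apply/subsetP => y; rewrite inE => /andP[].
  have /subsetPn[y] : ~~ (Q :\: Z4 \subset P :\: (x |: Z3)).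
    apply/negP => /subset_leq_card; rewrite -eP -eQ !cardsDS // (W_level PW) (W_level QW) eP eQ cardsU1 xZ3 c3 c4.
    by have [sr _ _] := below Z ZL; poslia.
  rewrite in_setD => /andP[yZ4 yQ]; have xy : x < y.
    by rewrite ltnNge; apply: contra yZ4 => yx; rewrite -inQ.
  have yxZ3 : y \notin x |: Z3 by rewrite -eP inE ltnS leqNgt xy andbF.
  rewrite in_setD yxZ3 => yP; apply: (W_noncrossing PW QW); exists z, z', x, y.
  split; first by have := ltn_ord y; split; poslia.
  move: zZ z'Z; rewrite !res_val !inE => /andP[zZ4 zZ3] /andP[z'Z3 z'Z4].
  rewrite yQ yP !inP ?inQ ?setU11 ?in_setU1 ?zZ3 ?zZ4 ?z'Z4 ?(negbTE z'Z3) ?(negbTE xZ4) ?orbT //; try poslia.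
  by rewrite orbF -val_eqE neq_ltn z'x.
have xnot Z3 : Z3 \in L -> x \notin Z3 by rewrite !inE => /andP[/andP[/andP[]]].
have lt_x Z3 : Z3 \in L -> forall y, y \in Z3 -> y < x.
  move=> Z3L y yZ3; have [_ _ [Y _ eY]] := unpack Z3 Z3L; rewrite ltn_neqAle; apply/andP; split.
    by apply: contraNneq (xnot Z3 Z3L) => /val_inj <-.
  by move: yZ3; rewrite -eY inE => /andP[].
have /subsetPn[z zZ1 zZ2] : ~~ (Z1 \subset Z2).
  by apply: contra ne => sub; rewrite eq_sym eqEcard sub e1 e2 /= leqnn.
have /subsetPn[z' z'Z2 z'Z1] : ~~ (Z2 \subset Z1).
  by apply: contra ne => sub; rewrite eqEcard sub e1 e2 /= leqnn.
have [lt|gt|e] := ltngtP z z'; last by rewrite (val_inj e) z'Z2 in zZ2.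
  by apply: (order Z1 Z2 z z' e1 e2 (xnot _ Z1L) (lt_x _ Z2L)) => //; rewrite inE ?zZ2 ?z'Z1.
by apply: (order Z2 Z1 z' z e2 e1 (xnot _ Z2L) (lt_x _ Z1L)) => //; rewrite inE ?zZ2 ?z'Z1.
Qed.

(** The one extra member is the only truncation at 0; each size [s < r] contributes at most once for
    each of [n - r] values of [j]. *)
Lemma level_bound : #|W| <= (r * (n - r)).+1.
Proof.
have step k : k <= n -> #|truncations k| <= 1 + \sum_(j < n | j < k) \sum_(s < r) (s <= j < s + (n - r)).
  elim: k => [_|k IH kn].
    rewrite (leq_trans _ (leq_addr _ _)) //; apply/card_le1_eqP => Z1 Z2 /imsetP[X _ ->] /imsetP[Y _ ->].
    by apply/setP => x; rewrite !inE !andbF.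
  apply: leq_trans (card_truncationsS (Ordinal kn)) _.
  rewrite (bigD1 (Ordinal kn)) //= addnCA addnC leq_add //; last first.
    apply: leq_trans (IH (ltnW kn)) _; rewrite leq_add2l; apply: eq_leq; apply: eq_bigl => j.
    by rewrite ltnS -val_eqE /= ltn_neqAle andbC.
  have size_le := card_link_size (Ordinal kn); rewrite /= in size_le.
  move: (link _ _ :&: _) size_le => /= L size_le.
  rewrite -sum1_card; apply: (@leq_trans (\sum_(Z in L) \sum_(s < r) (#|Z| == s))).
    apply: leq_sum => Z ZL; have Zr : #|Z| < r.
      have := size_le #|Z|; case: ltnP => // _; rewrite leqn0 cards_eq0 => /eqP/setP/(_ Z).
      by rewrite !inE ZL eqxx.
    by rewrite (bigD1 (Ordinal Zr)) //= eqxx.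
  rewrite exchange_big /=; apply: leq_sum => s _.
  have := size_le s; rewrite ltn_ord /=; apply: leq_trans.
  rewrite -sum1_card big_mkcond [leqRHS]big_mkcond /=; apply: leq_sum => Z _.
  by rewrite inE; case: (Z \in L); case: (_ == _).
have <- : #|truncations n| = #|W|.
  rewrite -[RHS](card_imset _ (@inj_id _)); congr #|pred_of_set _|; apply: eq_imset => X.
  by apply/setP => x; rewrite inE ltn_ord andbT.
apply: leq_trans (step n (leqnn n)) _; rewrite add1n ltnS.
under eq_bigl do rewrite ltn_ord.
have -> : r * (n - r) = \sum_(s < r) (n - r) by rewrite sum_nat_const card_ord.
rewrite exchange_big /=; apply: leq_sum => s _.
have sn : s + (n - r) <= n by have := ltn_ord s; poslia.
rewrite -[leqRHS](addKn s) -[leqRHS]muln1 -sum_nat_const_nat (big_nat_widen s _ n) //.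
rewrite (big_nat_widenl s 0) // big_mkord [leqRHS]big_mkcond /=.
by apply: leq_sum => j _; rewrite andbC; case: (_ && _).
Qed.

End LevelBound.

(** * Purity *)

Lemma card_by_size (T : finType) (C : {set {set T}}) K : (forall X, X \in C -> #|X| < K) ->
  #|C| = \sum_(s < K) #|[set X in C | #|X| == s]|.
Proof.
move=> CK; under eq_bigr => s _ do rewrite -sum1_card (eq_bigl _ _ (in_set _)) big_mkcondr.
rewrite exchange_big -sum1_card; apply: eq_bigr => X XC.
rewrite (bigD1 (Ordinal (CK X XC))) //= eqxx big1 // => s.
by rewrite -val_eqE /= eq_sym => /negbTE ->.
Qed.

(** Among [n + 1] points, [s * (n - s)] triples have their middle point at position [s]; this is the
    source of ['C(n.+1, 3)]. *)
Lemma sum_level_sizes n : \sum_(s < n.+1) (s * (n - s)).+1 = \sum_(s < 4) 'C(n, s).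
Proof.
have e : \sum_(s < n.+1) s * (n - s) = 'C(n.+1, 3).
  elim: n => [|n IH]; first by rewrite big_ord_recl big_ord0.
  rewrite big_ord_recr /= subnn muln0 addn0 binS -IH -bin2_sum big_mkord -big_split /=.
  by apply: eq_bigr => s _; rewrite subSn ?mulnS 1?addnC // -ltnS.
under eq_bigr do rewrite -addn1.
rewrite big_split /= e sum_nat_const card_ord muln1 !big_ord_recl big_ord0 /= bin0 bin1 binS.
rewrite /bump /= !add1n; lia.
Qed.

Section Purity.
Variables m r : nat.
Local Notation n := m.+1.
Implicit Types (U V X Y : {set 'I_n}) (A B C D W : {set {set 'I_n}}).

Lemma separated_systemP A :
  reflect (forall U V, U \in A -> V \in A -> ~ crossing U V) (separated_system A).
Proof.
apply: (iffP forallP) => [h U V UA VA | h U].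
  by apply/separatedP; move/implyP: (h U) => /(_ UA) /forallP /(_ V) /implyP; apply.
by apply/implyP => UA; apply/forallP => V; apply/implyP => VA; apply/separatedP/h.
Qed.

Lemma crossing_irreflexive U : ~ crossing U U.
Proof. by case=> p [q [s [t [_ []]]]]; rewrite setDv inE. Qed.

Lemma separated_systemU A B : separated_system A -> separated_system B ->
  (forall U V, U \in A -> V \in B -> ~ crossing U V) -> separated_system (A :|: B).
Proof.
move=> /separated_systemP hA /separated_systemP hB hAB; apply/separated_systemP => U V.
rewrite !inE => /orP[UA|UB] /orP[VA|VB]; [exact: hA | exact: hAB | | exact: hB].
by move/crossingC; apply: hAB.
Qed.

Lemma separated_systemS A B : A \subset B -> separated_system B -> separated_system A.
Proof.
by move=> /subsetP sub /separated_systemP h; apply/separated_systemP => U V /sub ? /sub ?; apply: h.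
Qed.

Definition max_separated D := maxset (fun A : {set {set 'I_n}} => (A \subset D) && separated_system A).

Lemma max_separated_exists D A : A \subset D -> separated_system A ->
  exists2 B, max_separated D B & A \subset B.
Proof.
move=> AD sA; have [|B maxB AB] := @maxset_exists _ (fun A => (A \subset D) && separated_system A) A.
  by rewrite AD.
by exists B.
Qed.

Lemma max_separatedP D A : max_separated D A ->
  [/\ A \subset D, separated_system A &
      forall X, X \in D -> (forall Y, Y \in A -> ~ crossing X Y) -> X \in A].
Proof.
move/maxsetP => [/andP[AD sA] maxA]; split=> // X XD nc.
rewrite -(maxA (X |: A)) ?setU11 ?subsetUr // subUset sub1set XD AD /=.
apply: separated_systemU => //.
  by apply/separated_systemP => U V; rewrite !inE => /eqP -> /eqP ->; apply: crossing_irreflexive.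
by move=> U V; rewrite inE => /eqP ->; apply: nc.
Qed.

Definition level : {set {set 'I_n}} := [set X : {set 'I_n} | #|X| == r].

Lemma max_separated_level W : r <= n -> max_separated level W -> #|W| = (r * (n - r)).+1.
Proof.
move=> rn /max_separatedP[/subsetP Wr sW Wmax].
have [C /max_separatedP[_ /separated_systemP sC Cmax] /subsetP WC] := max_separated_exists (subsetT W) sW.
have bound (s : 'I_n.+1) : #|[set X in C | #|X| == s]| <= (s * (n - s)).+1.
  apply: level_bound; last by rewrite -ltnS.
    by move=> X Y; rewrite !inE => /andP[XC _] /andP[YC _]; apply: sC.
  by move=> X; rewrite inE => /andP[_ /eqP].
(* Maximality of [W] within its level makes it a full level of [C]. *)
have eW : W = [set X in C | #|X| == r].
  apply/setP => X; apply/idP/idP => [XW|].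
    by rewrite inE WC //; move: (Wr X XW); rewrite inE.
  rewrite inE => /andP[XC Xr]; apply: Wmax; first by rewrite inE.
  by move=> Y YW; apply: sC => //; apply: WC.
have total : \sum_(s < n.+1) (s * (n - s)).+1 <= #|C|.
  apply: leq_trans (@maximal_card _ C sC _); last by move=> U; apply: Cmax; rewrite inE.
  rewrite sum_level_sizes (@card_by_size _ _ 4) => [|X]; last by rewrite inE.
  apply: eq_leq; apply: eq_bigr => s _; rewrite -[n in LHS]card_ord -card_draws; congr #|pred_of_set _|.
  apply/setP => X; rewrite !inE andbC; have [->|//] := eqVneq; by rewrite -ltnS ltn_ord.
have lt_rn : r < n.+1 by [].
apply/eqP; rewrite eqn_leq {1}eW (bound (Ordinal lt_rn)) /= eW.
rewrite (@card_by_size _ C n.+1) in total; last first.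
  by move=> X _; rewrite ltnS (leq_trans (max_card _)) // card_ord.
rewrite (bigD1 (Ordinal lt_rn)) //= [leqRHS](bigD1 (Ordinal lt_rn)) //= in total.
by rewrite -(leq_add2r (\sum_(s < n.+1 | s != Ordinal lt_rn) (s * (n - s)).+1)) (leq_trans total) //
  leq_add2l leq_sum.
Qed.

End Purity.

Theorem corollary2 (n r : nat) (n_ge1 : 1 <= n)
    (N1 N2 : 'I_n -> {set 'I_n})
    (N1_necklace : necklace r N1) (N2_necklace : necklace r N2)
    (N1_mem : forall i, i \in N1 i) (N2_mem : forall i, i \in N2 i)
    (I1_sep_N2 : separated_systems (interior r N1) (members N2))
    (I2_sep_N1 : separated_systems (interior r N2) (members N1)) :
  pure (interior r N1 :|: interior r N2).
Proof.
case: n n_ge1 => // m _ in N1 N2 N1_necklace N2_necklace N1_mem N2_mem I1_sep_N2 I2_sep_N1 *.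
set I1 := interior r N1; set I2 := interior r N2; set D := I1 :|: I2.
have rn : r <= m.+1 by rewrite -(necklace_card N1_necklace ord0) (leq_trans (max_card _)) // card_ord.
have Dlevel : D \subset level m r.
  by apply/subsetP => X; rewrite !inE => /orP[]/andP[].
have sep I N : separated_systems I (members N) -> forall X (i : 'I_m.+1), X \in I -> ~ crossing (N i) X.
  move=> s X i XI /crossingC; apply/separatedP.
  by move/forall_inP: s => /(_ X XI) /forall_inP; apply; apply: imset_f.
have N1D i X : X \in D -> ~ crossing (N1 i) X.
  by rewrite in_setU => /orP[|/(sep _ _ I2_sep_N1)]; [apply: interior_noncrossing | apply].
have N2D i X : X \in D -> ~ crossing (N2 i) X.
  by rewrite in_setU => /orP[/(sep _ _ I1_sep_N2)|]; [apply | apply: interior_noncrossing].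
have inD1 i : N1 i \in D.
  by rewrite in_setU (subsetP (members_interior N1_necklace)) ?imset_f.
have inD2 i : N2 i \in D.
  by rewrite in_setU (subsetP (members_interior N2_necklace)) ?imset_f ?orbT.
have le A B : max_separated D A -> max_separated D B -> #|B| <= #|A|.
  move=> /max_separatedP[AD sA Amax] /max_separatedP[BD sB _].
  have N1A i : N1 i \in A by apply: Amax => // Y /(subsetP AD); apply: N1D.
  have N2A i : N2 i \in A by apply: Amax => // Y /(subsetP AD); apply: N2D.
  have [A' maxA' AA'] := max_separated_exists (subset_trans AD Dlevel) sA.
  have [A'level sA' _] := max_separatedP maxA'.
  have /separated_systemP ncA' := sA'.
  have eA : A' :&: D = A.
    apply/setP => X; rewrite inE; apply/andP/idP => [[XA' XD]|XA]; last first.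
      by rewrite (subsetP AA') // (subsetP AD).
    by apply: Amax => // Y /(subsetP AA'); apply: ncA'.
  have outD X Y : X \in D -> Y \in A' :\: D -> ~ crossing X Y.
    rewrite [Y \in _]inE [Y \in D]in_setU negb_or => XD /andP[/andP[Y1 Y2] YA'].
    have Yr : #|Y| = r by move: (subsetP A'level Y YA'); rewrite inE => /eqP.
    have YN1 i : ~ crossing (N1 i) Y by apply: ncA' => //; apply: (subsetP AA').
    have YN2 i : ~ crossing (N2 i) Y by apply: ncA' => //; apply: (subsetP AA').
    move: XD; rewrite in_setU => /orP[X1|X2].
      exact: (interior_exterior N1_necklace X1 Yr YN1 Y1).
    exact: (interior_exterior N2_necklace X2 Yr YN2 Y2).
  have sBA' : separated_system (B :|: A' :\: D).
    apply: separated_systemU => //; first by apply: separated_systemS sA'; apply: subsetDl.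
    by move=> X Y /(subsetP BD); apply: outD.
  have level_BA' : B :|: A' :\: D \subset level m r.
    by rewrite subUset (subset_trans BD) // (subset_trans (subsetDl _ _)).
  (* Both sides of the bound contain the disjoint part [A' :\: D], which cancels: [A'] splits into
     [A] and this part. *)
  have := level_bound (separated_systemP _ sBA') _ rn.
  rewrite -(max_separated_level rn maxA') -(cardsID D A') eA cardsU.
  have -> : B :&: (A' :\: D) = set0.
    by apply/setP => X; rewrite in_setI in_setD in_set0; apply/negP => /and3P[/(subsetP BD) ->].
  rewrite cards0 subn0 leq_add2r; apply=> X /(subsetP level_BA').
  by rewrite inE => /eqP.
by move=> A B maxA maxB; apply/eqP; rewrite eqn_leq !le.
Qed.
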